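(* Let $1\le k<n$ and let $\mathcal A(k,n)\subseteq\operatorname{Gr}(k,n)$ be the maximal open positroid stratum. Then $\mathcal S(\mathcal A(k,n))=\emptyset$ if and only if $\gcd(k,n)=1$. In particular, if $\gcd(k,n)>1$ then $\mathcal D(\mathcal A(k,n))\ne\emptyset$.
   Context: $\mathcal A(k,n)$ is the open subvariety of $\operatorname{Gr}(k,n)$ of points represented by $k\times n$ complex matrices (modulo row operations) all of whose Plücker coordinates indexed by cyclic intervals of $k$ consecutive columns (modulo $n$) are nonzero. Its coordinate ring $A$ is a cluster algebra over $\mathbb{C}$ with invertible frozen variables, by Scott. The group $\operatorname{Aut}(A)$ of cluster automorphisms consists of the algebra automorphisms of $A$ sending each cluster variable to a nonzero scalar multiple of itself; here $\operatorname{Aut}(A)\cong(\mathbb{C}^\times)^{n}/\mathbb{C}^\times$ acting on $\mathcal A(k,n)$ by rescaling the columns. The stabilizer locus $\mathcal S(\mathcal A)$ is the set of points with nontrivial $\operatorname{Aut}(A)$-stabilizer. The deep locus $\mathcal D(\mathcal A)$ is the complement in $\mathcal A=\operatorname{Spec}A$ of the union, over all seeds, of the cluster tori (the open loci where all variables of the seed are nonzero). *)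

(* Defs.v *)
From HB Require Import structures.
From mathcomp Require Import all_boot all_order all_algebra.
From mathcomp Require Import boolp classical_sets functions reals.
From mathcomp Require Import complex.

Set Implicit Arguments.
Unset Strict Implicit.
Unset Printing Implicit Defensive.

Import Order.TTheory GRing.Theory Num.Theory.
Local Open Scope ring_scope.
Local Open Scope quotient_scope.
Local Open Scope complex_scope.

Section Seeds.
Variables (F : fieldType) (I : finType).

(* Fomin-Zelevinsky seed of geometric type in the ambient field [F].  The set
   of mutable indices is a parameter of [reachable] below. The exchange matrix
   is stored as a square matrix; its columns at frozen indices never enter an
   exchange relation, nor the other columns of a mutated matrix. *)
Record seed := Seed { cvar : I -> F; exch : I -> I -> int }.

Definition mutate_var (s : seed) (v : I) : F :=
  (\prod_(u | 0 < exch s u v) cvar s u ^+ `|exch s u v|%N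
   + \prod_(u | exch s u v < 0) cvar s u ^+ `|exch s u v|%N) / cvar s v.

Definition mutate_exch (s : seed) (v i j : I) : int :=
  if (i == v) || (j == v) then - exch s i j
  else exch s i j
       + Num.max (exch s i v) 0 * Num.max (exch s v j) 0
       - Num.max (- exch s i v) 0 * Num.max (- exch s v j) 0.

Definition mutate (s : seed) (v : I) : seed :=
  Seed (fun i => if i == v then mutate_var s v else cvar s i)
       (mutate_exch s v).

Inductive reachable (mutable : {pred I}) (s0 : seed) : seed -> Prop :=
| reachable_init : reachable mutable s0 s0
| reachable_mutate s v :
    reachable mutable s0 s -> v \in mutable ->
    reachable mutable s0 (mutate s v).

(* The frozen variables count as cluster variables. *)
Definition cluster_variable (mutable : {pred I}) (s0 : seed) (x : F) : Prop :=
  exists s i, reachable mutable s0 s /\ x = cvar s i.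

End Seeds.

Section Stratum.
Variables (R : realType) (k n : nat) (kn : (1 <= k < n)%N).

Let n_gt0 : (0 < n)%N.
Proof. by case/andP: kn => _; apply: leq_ltn_trans. Qed.

(* Columns are numbered from 0, modulo n. *)
Definition colmod (m : nat) : 'I_n := Ordinal (ltn_pmod m n_gt0).

Definition cyc (a : 'I_n) : 'I_k -> 'I_n := fun l => colmod (a + l).

(* The columns are listed in the order given by [J], so that for a cyclic
   interval wrapping around this is the Pluecker coordinate up to sign. *)
Definition plucker (J : 'I_k -> 'I_n) (M : 'M[R[i]]_(k, n)) : R[i] :=
  \det (colsub J M).

Definition cyc_generic (M : 'M[R[i]]_(k, n)) : bool :=
  [forall a : 'I_n, plucker (cyc a) M != 0].

Definition rep := {M : 'M[R[i]]_(k, n) | cyc_generic M}.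

(* Equality modulo row operations, i.e. equality of row spaces. *)
Definition roweq (M N : rep) : bool := (val M == val N)%MS.

Lemma roweqP (M N : rep) :
  reflect (exists2 g, g \in unitmx & val N = g *m val M) (roweq M N).
Proof.
apply: (iffP idP) => [/eqmxP e|[g gU e]]; last first.
  apply/eqmxP; rewrite e; apply: eqmx_sym.
  exact: eqmxMfull (etrans (row_full_unit g) gU).
have /submxP[g eg] : (val N <= val M)%MS by rewrite -e.
exists g => //.
have := forallP (valP N) (Ordinal n_gt0).
rewrite unitmxE unitfE; apply: contraNneq => g0.
by rewrite /plucker eg -mulmx_colsub det_mulmx g0 mul0r.
Qed.

Lemma roweq_refl : reflexive roweq.
Proof. by move=> M; rewrite /roweq !submx_refl. Qed.

Lemma roweq_sym : symmetric roweq.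
Proof. by move=> M N; rewrite /roweq andbC. Qed.

Lemma roweq_trans : transitive roweq.
Proof.
move=> N M P /andP[a b] /andP[c d]; apply/andP; split.
  exact: submx_trans a c.
exact: submx_trans d b.
Qed.

Canonical roweq_equiv := EquivRel roweq roweq_refl roweq_sym roweq_trans.

(* A(k,n) as a set of closed points. *)
Definition opos := {eq_quot roweq}.
HB.instance Definition _ : EqQuotient _ roweq opos := EqQuotient.on opos.
HB.instance Definition _ := Choice.on opos.

(* The function p |-> Delta_J(p) / Delta_[a,a+k-1](p). *)
Definition pratio (J : 'I_k -> 'I_n) (a : 'I_n) : opos -> R[i] :=
  fun p => plucker J (val (repr p)) / plucker (cyc a) (val (repr p)).

Lemma plucker_cyc_neq0 (M : rep) a : plucker (cyc a) (val M) != 0.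
Proof. exact: forallP (valP M) a. Qed.

Lemma pratio_pi J a (M : rep) :
  pratio J a (\pi M) = plucker J (val M) / plucker (cyc a) (val M).
Proof.
have /roweqP[g gU e] : roweq M (repr (\pi_opos M)).
  by have /eqmodP := esym (reprK (\pi_opos M)).
rewrite /pratio e /plucker -!mulmx_colsub !det_mulmx.
by rewrite -mulf_div divff ?mul1r // -unitfE -unitmxE.
Qed.

(* A(k,n) is the open subset D_+(prod_a Delta_[a,a+k-1]) of the projective
   variety Gr(k,n), so its coordinate ring is the degree 0 part of the
   homogeneous coordinate ring with the cyclic Pluecker coordinates inverted. *)
Inductive is_regular : (opos -> R[i]) -> Prop :=
| reg_const c : is_regular (fun=> c)
| reg_pratio J a : is_regular (pratio J a)
| reg_add f g : is_regular f -> is_regular g -> is_regular (f + g)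
| reg_mul f g : is_regular f -> is_regular g -> is_regular (f * g).

Definition regular : {pred opos -> R[i]} := fun f => `[< is_regular f >].

Lemma regularP f : reflect (is_regular f) (f \in regular).
Proof. exact: asboolP. Qed.

Lemma regular_subring : subring_closed regular.
Proof.
split=> [|f g /regularP rf /regularP rg|f g /regularP rf /regularP rg].
- by apply/regularP; apply: (reg_const 1).
- apply/regularP; apply: reg_add => //.
  have -> : - g = (fun=> - 1) * g by apply/funext => p /=; rewrite mulN1r.
  exact: reg_mul (reg_const _) rg.
- by apply/regularP; apply: reg_mul.
Qed.

HB.instance Definition _ := GRing.isSubringClosed.Build _ regular
  regular_subring.

Record coord_ring :=
  CoordRing { cfun :> opos -> R[i]; cfunP : cfun \in regular }.

HB.instance Definition _ := [isSub for cfun].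
HB.instance Definition _ := [Choice of coord_ring by <:].
HB.instance Definition _ :=
  GRing.SubChoice_isSubComPzRing.Build _ _ coord_ring regular_subring.

Lemma const_regular (c : R[i]) : (fun=> c) \in regular.
Proof. by apply/regularP; constructor. Qed.

Definition cconst c : coord_ring := CoordRing (const_regular c).

Definition cscale (c : R[i]) (f : coord_ring) : coord_ring := cconst c * f.

Lemma cscaleA a b f : cscale a (cscale b f) = cscale (a * b) f.
Proof. by rewrite /cscale mulrA; congr (_ * f); apply: val_inj. Qed.

Lemma cscale1 : left_id 1 cscale.
Proof. by move=> f; apply/val_inj/funext => p; apply: mul1r. Qed.

Lemma cscaleDr : right_distributive cscale +%R.
Proof. by move=> c f g; apply: mulrDr. Qed.

Lemma cscaleDl f : {morph cscale^~ f : a b / a + b}.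
Proof. by move=> a b; rewrite /cscale -mulrDl; congr (_ * f); apply: val_inj. Qed.

HB.instance Definition _ := GRing.Zmodule_isLmodule.Build R[i] coord_ring
  cscaleA cscale1 cscaleDr cscaleDl.

Lemma cfunE :
  (forall (c : R[i]) (f : coord_ring) p, (c *: f) p = c * f p) *
  (forall (f g : coord_ring) p, (f + g) p = f p + g p) *
  (forall (f g : coord_ring) p, (f * g) p = f p * g p) *
  (forall (f : coord_ring) p, (- f) p = - f p) *
  (forall p, (0 : coord_ring) p = 0) *
  (forall p, (1 : coord_ring) p = 1).
Proof. by []. Qed.

Lemma opos_inhabited : exists p : opos, True.
Proof.
pose r : 'rV[R[i]]_n := \row_j (j : nat)%:R.
pose M : 'M[R[i]]_(k, n) := \matrix_(i, j) r 0 j ^+ i.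
suff gM : cyc_generic M by exists (\pi_opos (exist _ M gM)).
apply/forallP => a; rewrite /plucker.
have -> : colsub (cyc a) M = Vandermonde k (colsub (cyc a) r).
  by apply/matrixP => i j; rewrite !mxE.
rewrite det_Vandermonde.
apply/prodf_neq0 => i _; apply/prodf_neq0 => j ltij.
rewrite !mxE subr_eq0 eqr_nat /= eqn_modDl.
have ltn (l : 'I_k) : (l < n)%N.
  by case/andP: kn => _; apply: ltn_trans.
by rewrite !modn_small // gtn_eqF.
Qed.

Lemma coord_ring_neq0 : (1 : coord_ring) != 0.
Proof.
have [p _] := opos_inhabited.
by apply/eqP => /(congr1 (fun f : coord_ring => f p)) /eqP; rewrite oner_eq0.
Qed.

HB.instance Definition _ :=
  GRing.PzSemiRing_isNonZero.Build coord_ring coord_ring_neq0.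

Lemma coord_ring_scaleAl (c : R[i]) (f g : coord_ring) :
  c *: (f * g) = (c *: f) * g.
Proof. by exact: mulrA. Qed.

HB.instance Definition _ :=
  GRing.Lmodule_isLalgebra.Build R[i] coord_ring coord_ring_scaleAl.
HB.instance Definition _ :=
  GRing.Lalgebra_isComAlgebra.Build R[i] coord_ring.

Definition cr_unit : {pred coord_ring} :=
  fun f => `[< exists g : coord_ring, g * f = 1 >].
Definition cr_inv (f : coord_ring) : coord_ring :=
  if pselect (exists g : coord_ring, g * f = 1) is left e
  then projT1 (cid e) else f.

Lemma cr_mulV : {in cr_unit, left_inverse 1 cr_inv *%R}.
Proof.
move=> f /asboolP uf; rewrite /cr_inv; case: pselect => // e.
by case: (cid e).
Qed.

Lemma cr_unitP (f g : coord_ring) : g * f = 1 -> cr_unit f.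
Proof. by move=> e; apply/asboolP; exists g. Qed.

Lemma cr_inv_out : {in [predC cr_unit], cr_inv =1 id}.
Proof.
move=> f /negP nuf; rewrite /cr_inv; case: pselect => // e.
by case: nuf; apply/asboolP.
Qed.

HB.instance Definition _ := GRing.ComNzRing_hasMulInverse.Build coord_ring
  cr_mulV cr_unitP cr_inv_out.

(* The variety is irreducible: restrict to a line in matrix space. *)
Section Line.
Variables P Q : 'M[R[i]]_(k, n).

Let line (t : R[i]) : 'M[R[i]]_(k, n) := P + t *: (Q - P).
Let pline (J : 'I_k -> 'I_n) : {poly R[i]} :=
  \det (colsub J (map_mx polyC P + 'X *: map_mx polyC (Q - P))).

Let plineE J t : (pline J).[t] = plucker J (line t).
Proof.
rewrite -[LHS]/(horner_eval t _) -det_map_mx; congr (\det _).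
by apply/matrixP => i j; rewrite !mxE /= horner_evalE !hornerE.
Qed.

Let is_regular_line f : is_regular f ->
  exists N D : {poly R[i]}, forall (M : rep) t, val M = line t ->
    D.[t] != 0 /\ f (\pi M) * D.[t] = N.[t].
Proof.
elim=> [c|J a|{}f g _ [Nf [Df hf]] _ [Ng [Dg hg]]
       |{}f g _ [Nf [Df hf]] _ [Ng [Dg hg]]].
- by exists c%:P, 1 => M t _; rewrite !hornerE oner_neq0.
- exists (pline J), (pline (cyc a)) => M t e.
  rewrite !plineE -e plucker_cyc_neq0; split=> //.
  by rewrite pratio_pi divfK ?plucker_cyc_neq0.
- exists (Nf * Dg + Ng * Df), (Df * Dg) => M t e.
  have [hf0 hf1] := hf M t e; have [hg0 hg1] := hg M t e.
  rewrite !hornerE mulf_neq0 //; split=> //.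
  by rewrite -hf1 -hg1 /= !mulrDl; congr (_ + _); rewrite mulrAC.
- exists (Nf * Ng), (Df * Dg) => M t e.
  have [hf0 hf1] := hf M t e; have [hg0 hg1] := hg M t e.
  rewrite !hornerE mulf_neq0 //; split=> //.
  by rewrite -hf1 -hg1 /= -!mulrA; congr (_ * _); rewrite mulrCA.
Qed.

Lemma line_mul_neq0 (p q : rep) (f g : opos -> R[i]) :
  val p = P -> val q = Q -> is_regular f -> is_regular g ->
  f (\pi p) != 0 -> g (\pi q) != 0 ->
  exists x, f x * g x != 0.
Proof.
move=> eP eQ /is_regular_line[Nf [Df hf]] /is_regular_line[Ng [Dg hg]] f0 g0.
pose L := \prod_a pline (cyc a).
have l0 : val p = line 0 by rewrite /line scale0r addr0.
have l1 : val q = line 1 by rewrite /line scale1r addrC subrK.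
have Nf0 : Nf != 0.
  have [d e] := hf p 0 l0; apply/eqP => z; move: e; rewrite z horner0.
  by move/eqP; rewrite mulf_eq0 (negPf f0) (negPf d).
have Ng0 : Ng != 0.
  have [d e] := hg q 1 l1; apply/eqP => z; move: e; rewrite z horner0.
  by move/eqP; rewrite mulf_eq0 (negPf g0) (negPf d).
have L0 : L != 0.
  apply/prodf_neq0 => a _; apply/eqP => z.
  have := plineE (cyc a) 0; rewrite z horner0 -l0 => /esym/eqP.
  by apply/negP; apply: plucker_cyc_neq0.
have H0 : L * (Nf * Ng) != 0 by rewrite !mulf_neq0.
pose ts : seq R[i] := [seq m%:R | m <- iota 0 (size (L * (Nf * Ng)))].
have : ~~ all (root (L * (Nf * Ng))) ts.
  apply/negP => /(max_poly_roots H0); rewrite map_inj_uniq ?iota_uniq => [/(_ isT)|].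
    by rewrite size_map size_iota ltnn.
  by move=> a b /eqP; rewrite eqr_nat => /eqP.
case/allPn => t _; rewrite /root !hornerM !mulf_eq0 !negb_or => /and3P[Lt Nft Ngt].
have gt : cyc_generic (line t).
  apply/forallP => a; rewrite -plineE; apply: contraNneq Lt => z.
  by rewrite /L horner_prod (bigD1 a) //= z mul0r.
pose M : rep := exist _ (line t) gt.
exists (\pi M).
have [_ ef] := hf M t erefl; have [_ eg] := hg M t erefl.
apply: mulf_neq0.
  by apply: contraNneq Nft => z; rewrite -ef z mul0r.
by apply: contraNneq Ngt => z; rewrite -eg z mul0r.
Qed.

End Line.

Lemma coord_ring_domain : GRing.integral_domain_axiom coord_ring.
Proof.
move=> f g fg0; apply/norP => -[f0 g0].
have nz (h : coord_ring) : h != 0 -> exists p, h p != 0.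
  move=> h0; apply/not_existsP => z; case/eqP: h0.
  by apply/val_inj/funext => p; apply/eqP; rewrite -[_ == _]negbK; apply/negP/z.
have [p fp] := nz _ f0; have [q gq] := nz _ g0.
rewrite -[p]reprK in fp; rewrite -[q]reprK in gq.
have [x] := line_mul_neq0 (erefl (val (repr p))) (erefl (val (repr q)))
  (regularP _ (cfunP f)) (regularP _ (cfunP g)) fp gq.
by rewrite -(cfunE.1.1.1.2 f g x) fg0 eqxx.
Qed.

HB.instance Definition _ :=
  GRing.ComUnitRing_isIntegral.Build coord_ring coord_ring_domain.

Lemma pratio_regular J a : pratio J a \in regular.
Proof. by apply/regularP; constructor. Qed.

Definition cpratio J a : coord_ring := CoordRing (pratio_regular J a).

(* The index (r, c) stands for the (r+1) x (c+1) rectangle inside the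
   k x (n-k) rectangle, equivalently for the k-subset
   {0, ..., k-r-2} u {k-r-1 + (c+1), ..., k-1 + (c+1)}. *)
Definition rect_idx : finType := ('I_k * 'I_(n - k))%type.

Definition rect_cols (u : rect_idx) : 'I_k -> 'I_n :=
  fun l => colmod (if l + u.1.+1 < k then l : nat else l + u.2.+1)%N.

(* A rectangle of full height or full width gives a cyclic interval. *)
Definition rect_mutable : {pred rect_idx} :=
  fun u => (u.1.+1 < k)%N && (u.2.+1 < n - k)%N.

(* Arrows of the rectangles quiver: r x c -> r x (c+1), r x c -> (r+1) x c
   and (r+1) x (c+1) -> r x c. *)
Definition rect_arrow (u v : rect_idx) : bool :=
  [|| (v.1 == u.1 :> nat) && (v.2 == u.2.+1 :> nat),
      (v.1 == u.1.+1 :> nat) && (v.2 == u.2 :> nat)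
    | (u.1 == v.1.+1 :> nat) && (u.2 == v.2.+1 :> nat)].

(* On Gr(k,n) itself, as opposed to its affine cone, the Pluecker coordinates
   are normalized by the n-th frozen variable Delta_{0,...,k-1}, the Pluecker
   coordinate of the empty rectangle. *)
Definition rect_seed : seed {fraction coord_ring} rect_idx :=
  Seed (fun u => FracField.tofrac (cpratio (rect_cols u) (colmod 0)))
       (fun u v => (rect_arrow u v)%:Z - (rect_arrow v u)%:Z).

Definition is_seed : seed {fraction coord_ring} rect_idx -> Prop :=
  reachable rect_mutable rect_seed.

(* The map induced on the fraction field by a ring automorphism (see
   frac_map_div). As cluster variables lie in coord_ring, by Scott's theorem,
   it acts on them simply as [phi] (see frac_map_tofrac). *)
Definition frac_map (phi : coord_ring -> coord_ring)
    (x : {fraction coord_ring}) : {fraction coord_ring} :=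
  FracField.tofrac (phi \n_(repr x)) / FracField.tofrac (phi \d_(repr x)).

Lemma frac_repr (D : idomainType) (x : {fraction D}) :
  x = FracField.tofrac \n_(repr x) / FracField.tofrac \d_(repr x).
Proof.
have d0 := denom_ratioP (repr x).
apply: (@mulIf _ (FracField.tofrac \d_(repr x))); first by rewrite tofrac_eq0.
rewrite divfK ?tofrac_eq0 // -{1}[x]reprK; unlock FracField.tofrac.
rewrite -[LHS]FracField.pi_mul; apply/eqmodP => /=.
rewrite FracField.equivfE /FracField.mulf.
by rewrite !numden_Ratio ?mulr1 ?oner_neq0 // mulrC.
Qed.

Lemma frac_map_div (phi : {rmorphism coord_ring -> coord_ring}) f g :
  injective phi -> g != 0 ->
  frac_map phi (FracField.tofrac f / FracField.tofrac g)
  = FracField.tofrac (phi f) / FracField.tofrac (phi g).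
Proof.
move=> iphi g0; rewrite /frac_map.
set x := (X in repr X); have := frac_repr x.
have := denom_ratioP (repr x); set r := repr x => d0 /eqP.
have nz h : h != 0 -> FracField.tofrac (phi h) != 0.
  by rewrite tofrac_eq0 -{2}(rmorph0 phi) (inj_eq iphi).
rewrite eqr_div ?tofrac_eq0 // -!tofracM tofrac_eq => /eqP e.
by apply/eqP; rewrite eqr_div ?nz // -!tofracM -!rmorphM e.
Qed.

Lemma frac_map_tofrac (phi : {rmorphism coord_ring -> coord_ring}) f :
  injective phi ->
  frac_map phi (FracField.tofrac f) = FracField.tofrac (phi f).
Proof.
move=> iphi; have := frac_map_div f iphi (oner_neq0 _).
by rewrite !rmorph1 !divr1.
Qed.

Definition cluster_automorphism (phi : {lrmorphism coord_ring -> coord_ring}) :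
    Prop :=
  bijective phi /\
  forall x : {fraction coord_ring}, cluster_variable rect_mutable rect_seed x ->
    exists2 c : R[i], c != 0 & frac_map phi x = FracField.tofrac (c%:A : coord_ring) * x.

(* [phi] maps the closed point p of Spec to p, i.e. ev_p \o phi = ev_p. *)
Definition fixes_point (phi : coord_ring -> coord_ring) (p : opos) : Prop :=
  forall f : coord_ring, phi f p = f p.

Definition stabilizer_locus : set opos :=
  [set p | exists phi : {lrmorphism coord_ring -> coord_ring},
     [/\ cluster_automorphism phi, fixes_point phi p & exists f, phi f <> f]].

Definition cluster_torus (s : seed {fraction coord_ring} rect_idx) : set opos :=
  [set p | forall u, exists2 f : coord_ring,
     cvar s u = FracField.tofrac f & f p != 0].

Definition deep_locus : set opos :=
  (~` \bigcup_(s in is_seed) cluster_torus s)%classic.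

End Stratum.

Arguments opos R {k n} kn.
Arguments coord_ring R {k n} kn.
Arguments stabilizer_locus R {k n} kn _.
Arguments deep_locus R {k n} kn _.

(* Main.v *)
Require Import Defs.
From HB Require Import structures.
From mathcomp Require Import all_boot all_order all_algebra perm.
From mathcomp Require Import boolp classical_sets functions reals.
From mathcomp Require Import complex ring zify.

(* Every weight function on the rectangle seed that makes the exchange
   relations homogeneous comes from a rescaling t of the columns, and mutation
   transports homogeneity, so column rescalings act by cluster automorphisms,
   with weights trivial on one seed if and only if trivial on all of them.

   If d = gcd(k,n) > 1, rescaling the columns of one residue class modulo d
   fixes a point whose matrix is block diagonal up to reordering by residues.
   This point has a nontrivial stabilizer, and it lies in no cluster torus:
   there the weights of all variables of the seed would be 1.

   If gcd(k,n) = 1, let phi fix p. The exchange relations of the rectangle seed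
   force the weights of phi to come from a column rescaling t. The frozen
   variables do not vanish at p, so their weights are 1, which says that
   t_(j+k) = t_j with indices modulo n. Hence t is constant and phi fixes the
   variables of the rectangle seed. These are solid minors of the matrix X in
   (I | X) and determine its entries one after the other, so phi = id. *)

Set Implicit Arguments.
Unset Strict Implicit.
Unset Printing Implicit Defensive.

Import Order.TTheory GRing.Theory Num.Theory.

(** * Weights on a seed and their mutation *)

Section MutationWeights.
Local Open Scope ring_scope.
Variables (F K : fieldType) (I : finType) (mutable : {pred I}).
Implicit Types (s : seed F I) (w : I -> K).

Definition skew_exch s := forall i j, exch s i j = - exch s j i.

(** Homogeneity in multiplicative form: the two monomials of the exchange relation at [v] have equal
    weight (see [balancedP]). *)
Definition balanced s w :=
  forall v, v \in mutable -> \prod_u w u ^ exch s u v = 1.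

(** The weight of the exchange numerator is read off its first monomial, which is legitimate when
    [w] is balanced. *)
Definition mutate_weight s (v : I) w (i : I) : K :=
  if i == v then (\prod_u w u ^ Num.max (exch s u v) 0) / w v else w i.

Lemma skew_diag s i : skew_exch s -> exch s i i = 0.
Proof. by move=> /(_ i i); lia. Qed.

Lemma mutate_skew s v : skew_exch s -> skew_exch (mutate s v).
Proof.
move=> sk i j; rewrite /= /mutate_exch orbC.
rewrite (sk i j) (sk i v) (sk v j).
by case: ifP => _ //; nia.
Qed.

Lemma mutate_weight_neq0 s v w :
  (forall i, w i != 0) -> forall i, mutate_weight s v w i != 0.
Proof.
move=> w0 i; rewrite /mutate_weight; case: ifP => // _.
by rewrite mulf_neq0 ?invr_eq0 //; apply/prodf_neq0 => u _; apply: expfz_neq0.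
Qed.

Lemma prod_exprz_split (w : I -> K) (b : I -> int) :
    (forall i, w i != 0) ->
  \prod_u w u ^ b u =
    \prod_u w u ^ Num.max (b u) 0 / \prod_u w u ^ Num.max (- b u) 0.
Proof.
move=> w0; rewrite -prodf_div; apply: eq_bigr => u _.
by rewrite invr_expz -expfzDr //; congr (_ ^ _); lia.
Qed.

Lemma prod_exprz_pos (w : I -> K) (b : I -> int) :
  \prod_u w u ^ Num.max (b u) 0 = \prod_(u | 0 < b u) w u ^+ `|b u|%N.
Proof.
rewrite [RHS]big_mkcond /=; apply: eq_bigr => u _.
case: ifP => h; last by rewrite (_ : Num.max _ _ = 0) //; lia.
by rewrite exprnP; congr (_ ^ _); lia.
Qed.

Lemma prod_exprz_neg (w : I -> K) (b : I -> int) :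
  \prod_u w u ^ Num.max (- b u) 0 = \prod_(u | b u < 0) w u ^+ `|b u|%N.
Proof.
rewrite [RHS]big_mkcond /=; apply: eq_bigr => u _.
case: ifP => h; last by rewrite (_ : Num.max _ _ = 0) //; lia.
by rewrite exprnP; congr (_ ^ _); lia.
Qed.

Lemma balancedP s w v : (forall i, w i != 0) ->
  \prod_u w u ^ exch s u v = 1 <->
  \prod_u w u ^ Num.max (exch s u v) 0
    = \prod_u w u ^ Num.max (- exch s u v) 0.
Proof.
move=> w0; rewrite prod_exprz_split //.
have n0 : \prod_u w u ^ Num.max (- exch s u v) 0 != 0.
  by apply/prodf_neq0 => u _; apply: expfz_neq0.
by split=> [/divr1_eq //|->]; rewrite divff.
Qed.

(** Column [v] only changes sign. In a column [j != v] with [b = exch s v j], the terms added by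
    mutation contribute [P ^ b], where [P] is the common weight of the two exchange monomials at
    [v]. This cancels the [P] in the new weight [P / w v], which now carries the exponent [- b]. *)
Lemma mutate_balanced s v w :
  (forall i, w i != 0) -> skew_exch s -> v \in mutable ->
  balanced s w -> balanced (mutate s v) (mutate_weight s v w).
Proof.
move=> w0 sk mv bal j mj.
have w'0 := mutate_weight_neq0 s v w0.
have PN := (balancedP s v w0).1 (bal v mv).
set P := \prod_u w u ^ Num.max (exch s u v) 0 in PN.
have P0 : P != 0 by apply/prodf_neq0 => u _; apply: expfz_neq0.
have [->|nj] := eqVneq j v.
  rewrite -[RHS]invr1 -[X in _ = X^-1](bal v mv) -prodfV; apply: eq_bigr => u _.
  rewrite /mutate_weight /= /mutate_exch eqxx orbT.
  case: eqP => [->|_]; first by rewrite skew_diag // oppr0 !expr0z invr1.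
  by rewrite invr_expz.
have off (b : int -> int) : b 0 = 0 ->
    \prod_(i | i != v) w i ^ b (exch s i v) = \prod_i w i ^ b (exch s i v).
  by move=> b0; rewrite [RHS](bigD1 v) //= skew_diag // b0 expr0z mul1r.
have prodXz (f : I -> K) z : \prod_(i | i != v) f i ^ z
    = (\prod_(i | i != v) f i) ^ z.
  by rewrite (big_morph _ (fun x y => expfzMl x y z) (exp1rz _ z)).
rewrite (bigD1 v) //= /mutate_weight eqxx /mutate_exch eqxx /= -/P.
set b := exch s v j; have := bal j mj; rewrite (bigD1 v) //= -/b => balj.
rewrite [X in _ * X](_ : _ = \prod_(i | i != v) w i ^ exch s i j
    * (P ^ Num.max b 0 / P ^ Num.max (- b) 0)).
  rewrite expfzMl exprz_inv opprK.
  have e : P ^ Num.max b 0 / P ^ Num.max (- b) 0 = P ^ b.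
    by rewrite invr_expz -expfzDr //; congr (_ ^ _); lia.
  by rewrite e [_ * P ^ b]mulrC mulrACA balj mulr1 -expfzDr // addNr expr0z.
have eP : \prod_(i | i != v) w i ^ Num.max (exch s i v) 0 = P.
  exact: off (fun b => Num.max b 0) (maxxx _).
have eN : \prod_(i | i != v) w i ^ Num.max (- exch s i v) 0 = P.
  by rewrite PN -(off (fun b => Num.max (- b) 0)) // oppr0 maxxx.
rewrite -[X in _ / X ^ _]eN -eP -!prodXz -prodf_div -big_split /=.
apply: eq_bigr => i iv; rewrite (negPf iv) (negPf nj) /=.
by rewrite !exprz_exp invr_expz -!expfzDr // addrA.
Qed.

(** Weights away from [v] are kept; once they are 1, the new weight at [v] is the inverse of [w v],
    since [exch s v v = 0]. *)
Lemma mutate_weight_eq1 s v w : skew_exch s ->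
  (forall i, mutate_weight s v w i = 1) -> forall i, w i = 1.
Proof.
move=> sk w1.
have w1' i : i != v -> w i = 1.
  by move=> iv; have := w1 i; rewrite /mutate_weight (negPf iv).
move=> i; have [->|/w1'//] := eqVneq i v.
have := w1 v; rewrite /mutate_weight eqxx (bigD1 v) //= skew_diag // maxxx.
rewrite expr0z mul1r big1 => [|u /w1' ->]; last by rewrite exp1rz.
by rewrite div1r => /(congr1 GRing.inv); rewrite invrK invr1.
Qed.

End MutationWeights.

(** * Eigenvectors of the map induced on the fraction field *)

Section Scaling.
Local Open Scope ring_scope.
Local Open Scope complex_scope.
Variables (R : realType) (k n : nat) (kn : (1 <= k < n)%N).
Local Notation A := (coord_ring R kn).
Local Notation K := {fraction A}.
Local Notation toK := (@FracField.tofrac A).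
Variable phi : {lrmorphism A -> A}.
Hypothesis phi_inj : injective phi.

(** [frac_map] is defined by chosen representatives, but [frac_map_div] computes it on any fraction,
    so the usual formulas for fractions apply. *)
Lemma frac_mapM : {morph frac_map phi : x y / x * y}.
Proof.
move=> x y; rewrite (frac_repr x) (frac_repr y) mulf_div -!tofracM.
rewrite !frac_map_div ?mulf_neq0 ?denom_ratioP //.
by rewrite mulf_div -!tofracM -!rmorphM.
Qed.

Lemma frac_map_denom_neq0 (x : K) : toK (phi \d_(repr x)) != 0.
Proof. by rewrite tofrac_eq0 -(rmorph0 phi) (inj_eq phi_inj) denom_ratioP. Qed.

Lemma frac_mapD : {morph frac_map phi : x y / x + y}.
Proof.
move=> x y; rewrite (frac_repr x) (frac_repr y).
rewrite addf_div ?tofrac_eq0 ?denom_ratioP // -!tofracM -!tofracD.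
rewrite !frac_map_div ?mulf_neq0 ?denom_ratioP //.
by rewrite addf_div ?frac_map_denom_neq0 // -!tofracM -tofracD rmorphD !rmorphM.
Qed.

Lemma frac_map1 : frac_map phi 1 = 1.
Proof. by rewrite -tofrac1 frac_map_tofrac // rmorph1. Qed.

Lemma frac_map0 : frac_map phi 0 = 0.
Proof. by rewrite -tofrac0 frac_map_tofrac // rmorph0. Qed.

Lemma frac_mapV : {morph frac_map phi : x / x^-1}.
Proof.
move=> x; have [->|x0] := eqVneq x 0; first by rewrite invr0 frac_map0 invr0.
have /(canRL (mulKf _)) : frac_map phi x * frac_map phi x^-1 = 1.
  by rewrite -frac_mapM divff ?frac_map1.
rewrite mulr1; apply; apply: contra_neq (oner_neq0 K) => z.
by rewrite -frac_map1 -(divff x0) frac_mapM z mul0r.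
Qed.

Definition scales (c : R[i]) (x : K) := frac_map phi x = toK c%:A * x.

Lemma toK_alg1 : toK 1%:A = 1.
Proof. by rewrite scale1r tofrac1. Qed.

Lemma toK_algM (c d : R[i]) : toK (c * d)%:A = toK c%:A * toK d%:A.
Proof. by rewrite -tofracM -scalerAl mul1r scalerA. Qed.

Lemma toK_alg_neq0 (c : R[i]) : c != 0 -> toK c%:A != 0.
Proof.
move=> c0; apply: contra_neq (oner_neq0 K) => z.
by rewrite -toK_alg1 -(divff c0) toK_algM z mul0r.
Qed.

Lemma toK_algV (c : R[i]) : c != 0 -> toK (c^-1)%:A = (toK c%:A)^-1.
Proof.
move=> c0; apply: (mulfI (toK_alg_neq0 c0)).
by rewrite -toK_algM !divff ?toK_alg_neq0 // toK_alg1.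
Qed.

Lemma scales1 : scales 1 1.
Proof. by rewrite /scales frac_map1 toK_alg1 mulr1. Qed.

Lemma scalesM c d x y : scales c x -> scales d y -> scales (c * d) (x * y).
Proof. by rewrite /scales frac_mapM toK_algM => -> ->; rewrite mulrACA. Qed.

Lemma scalesD c x y : scales c x -> scales c y -> scales c (x + y).
Proof. by rewrite /scales frac_mapD mulrDr => -> ->. Qed.

Lemma scalesV c x : c != 0 -> scales c x -> scales c^-1 x^-1.
Proof.
by move=> c0; rewrite /scales frac_mapV toK_algV // => ->; rewrite invfM.
Qed.

Lemma scalesX c x m : scales c x -> scales (c ^+ m) (x ^+ m).
Proof.
move=> h; elim: m => [|m IH]; first exact: scales1.
by rewrite !exprS; apply: scalesM.
Qed.

Lemma scales_prod (I : finType) (P : pred I) (c : I -> R[i]) (x : I -> K) :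
  (forall u, scales (c u) (x u)) ->
  scales (\prod_(u | P u) c u) (\prod_(u | P u) x u).
Proof.
by move=> h; apply: (big_ind2 scales scales1) => [????|u _]; [apply: scalesM|].
Qed.

Definition graded (I : finType) (mutable : {pred I}) (s : seed K I)
    (w : I -> R[i]) :=
  [/\ skew_exch s, balanced mutable s w, forall u, w u != 0
    & forall u, scales (w u) (cvar s u)].

(** A sum is an eigenvector when both summands have the same eigenvalue; for the two exchange
    monomials this is exactly balance at [v]. *)
Lemma mutate_graded (I : finType) (mutable : {pred I}) s v (w : I -> R[i]) :
  v \in mutable -> graded mutable s w ->
  graded mutable (mutate s v) (mutate_weight s v w).
Proof.
move=> mv [sk bal w0 sc]; split.
- exact: mutate_skew.
- exact: mutate_balanced.
- exact: mutate_weight_neq0.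
move=> u; rewrite /= /mutate_weight; case: ifP => // _.
rewrite /mutate_var; apply: scalesM; last exact: scalesV.
have scX (P : pred I) :
    scales (\prod_(u | P u) w u ^+ `|exch s u v|%N)
           (\prod_(u | P u) cvar s u ^+ `|exch s u v|%N).
  by apply: scales_prod => ?; apply: scalesX.
apply: scalesD; last rewrite (balancedP s v w0).1 ?bal //.
  by rewrite prod_exprz_pos; apply: scX.
by rewrite prod_exprz_neg; apply: scX.
Qed.

(** The last clause runs backwards along the mutations: a nontrivial weight on the initial seed
    stays visible on every reachable seed. *)
Lemma reachable_graded (I : finType) (mutable : {pred I}) s0 s (w0 : I -> R[i]) :
    graded mutable s0 w0 -> reachable mutable s0 s ->
  exists2 w, graded mutable s w
    & (forall u, w u = 1) -> forall u, w0 u = 1.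
Proof.
move=> g0; elim=> [|{}s v _ [w gw w1] mv]; first by exists w0.
exists (mutate_weight s v w); first exact: mutate_graded.
by case: gw => sk _ _ _ /(mutate_weight_eq1 sk).
Qed.

End Scaling.

(** * Column rescalings acting on points and on the coordinate ring *)

Section TorusAction.
Local Open Scope ring_scope.
Local Open Scope complex_scope.
Local Open Scope quotient_scope.
Variables (R : realType) (k n : nat) (kn : (1 <= k < n)%N).
Local Notation A := (coord_ring R kn).
Implicit Type t : {ffun 'I_n -> R[i]}.

Definition col_scale t (M : 'M[R[i]]_(k, n)) := M *m diag_mx (\row_j t j).

Lemma plucker_col_scale t J M :
  plucker J (col_scale t M) = (\prod_l t (J l)) * plucker J M.
Proof.
rewrite /plucker (_ : colsub J (col_scale t M)
    = colsub J M *m diag_mx (\row_l t (J l))); last first.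
  by apply/matrixP => i j; rewrite /col_scale !mul_mx_diag !mxE.
rewrite det_mulmx det_diag mulrC; congr (_ * _).
by apply: eq_bigr => l _; rewrite !mxE.
Qed.

Lemma col_scale_generic t (M : rep R kn) :
  (forall j, t j != 0) -> cyc_generic kn (col_scale t (val M)).
Proof.
move=> t0; apply/forallP => a; rewrite plucker_col_scale.
by rewrite mulf_neq0 ?plucker_cyc_neq0 //; apply/prodf_neq0.
Qed.

Variables (t : {ffun 'I_n -> R[i]}) (t0 : forall j, t j != 0).

Definition rep_scale (M : rep R kn) : rep R kn :=
  exist _ (col_scale t (val M)) (col_scale_generic M t0).

Definition opos_scale (p : opos R kn) : opos R kn :=
  \pi_(opos R kn) (rep_scale (repr p)).

(** Row operations multiply on the left and rescalings on the right, so they commute and the chosen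
    representative is irrelevant. *)
Lemma opos_scale_pi (M : rep R kn) :
  opos_scale (\pi_(opos R kn) M) = \pi_(opos R kn) (rep_scale M).
Proof.
apply/eqmodP; rewrite [X in is_true X]roweq_sym /=.
have /eqmodP/roweqP[g gU e] := esym (reprK (\pi_(opos R kn) M)).
by apply/roweqP; exists g; rewrite //= e /col_scale mulmxA.
Qed.

Definition torus_weight (J : 'I_k -> 'I_n) a :=
  (\prod_l t (J l)) / \prod_l t (cyc kn a l).

Lemma pratio_scale J a p :
  pratio J a (opos_scale p) = torus_weight J a * pratio J a p.
Proof.
rewrite -{2}[p]reprK -[p in LHS]reprK opos_scale_pi !pratio_pi /=.
by rewrite !plucker_col_scale mulf_div.
Qed.

Lemma regular_scale f : is_regular (kn := kn) f -> is_regular (f \o opos_scale).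
Proof.
elim=> [c|J a|{}f g _ hf _ hg|{}f g _ hf _ hg].
- exact: reg_const.
- have -> : pratio J a \o opos_scale
      = (fun=> torus_weight J a) * pratio (kn := kn) J a.
    by apply/funext => p; apply: pratio_scale.
  by apply: reg_mul; [apply: reg_const|apply: reg_pratio].
- exact: reg_add hf hg.
- exact: reg_mul hf hg.
Qed.

Lemma regular_scaleP (f : A) : (f \o opos_scale) \in regular (kn := kn).
Proof. by apply/regularP/regular_scale/regularP/cfunP. Qed.

Definition torus_pull (f : A) : A := CoordRing (regular_scaleP f).

Fact torus_pull_zmod : zmod_morphism torus_pull.
Proof. by move=> f g; apply/val_inj/funext. Qed.

Fact torus_pull_monoid : monoid_morphism torus_pull.
Proof. by split=> [|f g]; apply/val_inj/funext. Qed.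

Fact torus_pull_scalable : scalable torus_pull.
Proof. by move=> c f; apply/val_inj/funext. Qed.

HB.instance Definition _ := GRing.isZmodMorphism.Build _ _ torus_pull
  torus_pull_zmod.
HB.instance Definition _ := GRing.isMonoidMorphism.Build _ _ torus_pull
  torus_pull_monoid.
HB.instance Definition _ := GRing.isScalable.Build _ _ _ _ torus_pull
  torus_pull_scalable.

Lemma torus_pull_cpratio J a :
  torus_pull (cpratio R kn J a) = torus_weight J a *: cpratio R kn J a.
Proof. by apply/val_inj/funext => p; apply: pratio_scale. Qed.

End TorusAction.

Section TorusActionBij.
Local Open Scope ring_scope.
Local Open Scope complex_scope.
Local Open Scope quotient_scope.
Variables (R : realType) (k n : nat) (kn : (1 <= k < n)%N).
Variables (t u : {ffun 'I_n -> R[i]}).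
Variables (t0 : forall j, t j != 0) (u0 : forall j, u j != 0).

Lemma opos_scaleK : (forall j, t j * u j = 1) ->
  cancel (opos_scale (kn := kn) t0) (opos_scale u0).
Proof.
move=> tu p; rewrite [X in opos_scale u0 X]/opos_scale opos_scale_pi.
rewrite -[RHS]reprK; congr (\pi_(opos R kn) _).
apply: val_inj; apply/matrixP => i j.
by rewrite /= /col_scale !mul_mx_diag !mxE -mulrA tu mulr1.
Qed.

Lemma torus_pullK : (forall j, t j * u j = 1) ->
  cancel (torus_pull (kn := kn) u0) (torus_pull t0).
Proof.
by move=> tu f; apply/val_inj/funext => p; rewrite /= opos_scaleK.
Qed.

End TorusActionBij.

Lemma torus_pull_bij (R : realType) (k n : nat) (kn : (1 <= k < n)%N)
    (t : {ffun 'I_n -> R[i]%C}) (t0 : forall j, t j != 0%R) :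
  bijective (torus_pull (kn := kn) t0).
Proof.
have u0 j : [ffun j => (t j)^-1]%R j != 0%R by rewrite ffunE invr_eq0.
exists (torus_pull u0); apply: torus_pullK => j; rewrite ffunE.
  by rewrite mulVf.
by rewrite mulfV.
Qed.

(** * Weights on the rectangle seed *)

Section RectangleWeights.
Local Open Scope ring_scope.

(* Extends [x] by 1 to rectangles of height or width 0, and outside the range. *)
Definition rect_ext (S : comNzRingType) k n (x : rect_idx k n -> S) (r c : nat) :=
  \prod_(u : rect_idx k n | (u.1.+1 == r) && (u.2.+1 == c)) x u.

Lemma rect_extE (S : comNzRingType) k n (x : rect_idx k n -> S)
    (u : rect_idx k n) :
  rect_ext x u.1.+1 u.2.+1 = x u.
Proof.
by rewrite /rect_ext (big_pred1 u) // => v; rewrite !eqSS.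
Qed.

Lemma rect_ext_0l (S : comNzRingType) k n (x : rect_idx k n -> S) c :
  rect_ext x 0 c = 1.
Proof. by rewrite /rect_ext big_pred0. Qed.

Lemma rect_ext_0r (S : comNzRingType) k n (x : rect_idx k n -> S) r :
  rect_ext x r 0 = 1.
Proof. by rewrite /rect_ext big_pred0 // => u; rewrite andbF. Qed.

Lemma rect_ext_val (S : comNzRingType) k n (W : nat -> nat -> S) r c :
  (forall c, W 0%N c = 1) -> (forall r, W r 0%N = 1) ->
  (r <= k)%N -> (c <= n - k)%N ->
  rect_ext (fun u : rect_idx k n => W u.1.+1 u.2.+1) r c = W r c.
Proof.
move=> W0 W1; case: r => [|r] rk; first by rewrite rect_ext_0l W0.
case: c => [|c] ck; first by rewrite rect_ext_0r W1.
exact: (@rect_extE S k n (fun u => W u.1.+1 u.2.+1) (Ordinal rk, Ordinal ck)).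
Qed.

(** The extension by 1 makes the formula uniform: neighbours missing at the boundary contribute
    1. *)
Lemma prod_rect_in (S : comNzRingType) k n (x : rect_idx k n -> S)
    (v : rect_idx k n) :
  \prod_(u | rect_arrow u v) x u =
  rect_ext x v.1.+1 v.2 * rect_ext x v.1 v.2.+1 * rect_ext x v.1.+2 v.2.+2.
Proof.
rewrite /rect_ext !(big_mkcond (fun u : rect_idx k n => _ && _)).
rewrite [LHS]big_mkcond -!big_split /=; apply: eq_bigr => u _.
rewrite /rect_arrow; case: u v => [[i ?] [j ?]] [[i' ?] [j' ?]] /=.
by do 4![case: ifP => ?]; rewrite ?mul1r ?mulr1 //; lia.
Qed.

Lemma prod_rect_out (S : comNzRingType) k n (x : rect_idx k n -> S)
    (v : rect_idx k n) :
  \prod_(u | rect_arrow v u) x u =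
  rect_ext x v.1.+1 v.2.+2 * rect_ext x v.1.+2 v.2.+1 * rect_ext x v.1 v.2.
Proof.
rewrite /rect_ext !(big_mkcond (fun u : rect_idx k n => _ && _)).
rewrite [LHS]big_mkcond -!big_split /=; apply: eq_bigr => u _.
rewrite /rect_arrow; case: u v => [[i ?] [j ?]] [[i' ?] [j' ?]] /=.
by do 4![case: ifP => ?]; rewrite ?mul1r ?mulr1 //; lia.
Qed.

(** Without 2-cycles the exchange matrix has entries 0, 1 and -1, and the sign of an entry tells the
    direction of the arrow. *)
Lemma rect_arrow_asym k n (u v : rect_idx k n) :
  rect_arrow u v -> rect_arrow v u = false.
Proof.
by rewrite /rect_arrow; case: u v => [[i ?] [j ?]] [[i' ?] [j' ?]] /=; lia.
Qed.

Section Seed.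
Variables (R : realType) (k n : nat) (kn : (1 <= k < n)%N).
Local Notation b := (exch (rect_seed R kn)).

Lemma rect_seed_skew : skew_exch (rect_seed R kn).
Proof. by move=> i j; rewrite /= opprB. Qed.

Lemma prod_exch_pos (S : comNzRingType) (x : rect_idx k n -> S)
    (v : rect_idx k n) :
  \prod_(u | 0 < b u v) x u ^+ `|b u v|%N = \prod_(u | rect_arrow u v) x u.
Proof.
apply: eq_big => u /=; have := @rect_arrow_asym _ _ u v;
  by case: (rect_arrow u v) => [/(_ isT) ->|_] //=; case: rect_arrow.
Qed.

Lemma prod_exch_neg (S : comNzRingType) (x : rect_idx k n -> S)
    (v : rect_idx k n) :
  \prod_(u | b u v < 0) x u ^+ `|b u v|%N = \prod_(u | rect_arrow v u) x u.
Proof.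
apply: eq_big => u /=; have := @rect_arrow_asym _ _ v u;
  by case: (rect_arrow v u) => [/(_ isT) ->|_] //=; case: rect_arrow.
Qed.

Lemma rect_balancedP (K : fieldType) (w : rect_idx k n -> K) :
  (forall u, w u != 0) ->
  balanced (@rect_mutable k n) (rect_seed R kn) w <->
  forall v : rect_idx k n, v \in @rect_mutable k n ->
    \prod_(u | rect_arrow u v) w u = \prod_(u | rect_arrow v u) w u.
Proof.
move=> w0; have E v : \prod_u w u ^ b u v = 1 <->
    \prod_(u | rect_arrow u v) w u = \prod_(u | rect_arrow v u) w u.
  rewrite -prod_exch_pos -prod_exch_neg -prod_exprz_pos -prod_exprz_neg.
  exact: balancedP.
by split=> h v /h /E.
Qed.

End Seed.

(* Homogeneity of the exchange relation at the [r.+1] x [c.+1] rectangle, where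
   [W r c] is the weight of the [r] x [c] rectangle. *)
Definition hex_balanced (K : fieldType) (k m : nat) (W : nat -> nat -> K) :=
  forall r c, (r.+1 < k)%N -> (c.+1 < m)%N ->
  W r.+1 c * W r c.+1 * W r.+2 c.+2 = W r.+1 c.+2 * W r.+2 c.+1 * W r c.

(* With [P m] the product of the first [m] column weights, this is the weight
   of the normalized Pluecker coordinate of the [r] x [c] rectangle. *)
Definition rweight (K : fieldType) (P : nat -> K) (k r c : nat) :=
  P (k + c)%N * P (k - r)%N / (P (k - r + c)%N * P k).

Lemma rweight_0l (K : fieldType) (P : nat -> K) k c :
  (forall m, P m != 0) -> rweight P k 0 c = 1.
Proof. by move=> P0; rewrite /rweight subn0 divff ?mulf_neq0. Qed.

Lemma rweight_0r (K : fieldType) (P : nat -> K) k r :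
  (forall m, P m != 0) -> rweight P k r 0 = 1.
Proof. by move=> P0; rewrite /rweight !addn0 [P k * _]mulrC divff ?mulf_neq0. Qed.

Lemma rweight_neq0 (K : fieldType) (P : nat -> K) k r c :
  (forall m, P m != 0) -> rweight P k r c != 0.
Proof. by move=> P0; rewrite !mulf_neq0 ?invr_eq0 ?mulf_neq0. Qed.

(** The three rectangles on either side have the same heights, the same widths and the same
    differences of width and height, and each factor of [rweight] depends on at most one of
    these. *)
Lemma rweight_balanced (K : fieldType) (P : nat -> K) k m :
  (forall m, P m != 0) -> hex_balanced k m (rweight P k).
Proof.
move=> P0 r c rk _; rewrite /rweight.
(* Writing [k] as a sum removes the truncated subtractions. *)
have [a ->] : exists a, k = (r.+2 + a)%N by exists (k - r.+2)%N; lia.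
set k1 := (r.+2 + a)%N.
have -> : (k1 - r.+2)%N = a by lia.
have -> : (k1 - r.+1)%N = a.+1 by lia.
have -> : (k1 - r)%N = a.+2 by lia.
rewrite !addnS !addSn.
by field; rewrite !P0.
Qed.

(** The relation determines the weight of its largest rectangle from five rectangles with a smaller
    sum of height and width. *)
Lemma hex_balanced_unique (K : fieldType) k m (W V : nat -> nat -> K) :
  (forall r c, W r c != 0) ->
  hex_balanced k m W -> hex_balanced k m V ->
  (forall r c, (r <= 1)%N || (c <= 1)%N -> (r <= k)%N -> (c <= m)%N ->
     W r c = V r c) ->
  forall r c, (r <= k)%N -> (c <= m)%N -> W r c = V r c.
Proof.
move=> W0 hW hV h1 r c.
have [s] := ubnP (r + c); elim: s r c => // s IH r c rcs rk cm.
have [|] := boolP ((r <= 1)%N || (c <= 1)%N) => [/h1->//|].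
case: r c rcs rk cm => [|[|r]] [|[|c]] //= rcs rk cm _.
have := hW r c rk cm; have := hV r c rk cm.
rewrite -(IH r.+1 c) -1?(IH r c.+1) -1?(IH r.+1 c.+2) -1?(IH r.+2 c.+1)
  -1?(IH r c); try lia.
by move=> <- /mulfI; apply; rewrite mulf_neq0.
Qed.

(* The row and column of size 1 can be prescribed arbitrarily by rescaling
   columns, and they determine all other weights. *)
Lemma hex_balanced_rweight (K : fieldType) k m (W : nat -> nat -> K) :
  (0 < k)%N ->
  (forall r c, W r c != 0) ->
  (forall c, W 0%N c = 1) -> (forall r, W r 0%N = 1) ->
  hex_balanced k m W ->
  exists2 t : nat -> K, forall j, t j != 0
    & forall r c, (r <= k)%N -> (c <= m)%N ->
        W r c = rweight (fun m => \prod_(l < m) t l) k r c.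
Proof.
move=> k0 W0 Wl Wr bal.
(* The weights to be matched are [t (k + c - 1) / t (k - 1)] for size 1 x c and [t k / t (k - r)]
   for size r x 1. The common factor of all column weights is free and is chosen so that
   [t (k - 1) = 1]. *)
pose t j := if (j < k)%N then W 1%N 1%N / W (k - j)%N 1%N else W 1%N (j - k).+1.
have t0 j : t j != 0.
  by rewrite /t; case: ifP; rewrite // mulf_neq0 ?invr_eq0.
pose P m := \prod_(l < m) t l.
exists t => //; rewrite -/P.
have P0 j : P j != 0 by apply/prodf_neq0.
have PS j : P j.+1 = P j * t j by rewrite /P big_ord_recr.
apply: hex_balanced_unique => //; first exact: rweight_balanced.
case=> [|r] [|c]; rewrite ?rweight_0l ?rweight_0r // => rc rk cm.
case: r rc rk => [_ _|r rc rk]; last case: c cm rc => // _ _.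
  rewrite /rweight addnS PS.
  have -> : (k - 1 + c.+1 = k + c)%N by lia.
  have -> : P k = P k.-1 * t k.-1 by rewrite -PS prednK.
  rewrite subn1.
  have -> : t (k + c)%N = W 1%N c.+1.
    by rewrite /t ltnNge leq_addr /= addKn.
  have -> : t k.-1 = 1.
    by rewrite /t ltn_predL k0 (_ : k - k.-1 = 1)%N ?divff //; lia.
  by field; rewrite !P0.
rewrite /rweight !addn1 !PS.
have -> : t k = W 1%N 1%N by rewrite /t ltnn subnn.
have -> : t (k - r.+2)%N = W 1%N 1%N / W r.+2 1%N.
  by rewrite /t subKn // (_ : (_ < _)%N) //; lia.
by field; rewrite !P0 !W0.
Qed.

(** Together the two hypotheses say that [t] is invariant under adding [k] modulo [n], and [k]
    generates the integers modulo [n]. *)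
Lemma cyclic_const (T : Type) (k n : nat) (t : nat -> T) :
  coprime k n -> (k < n)%N ->
  (forall c, (c < n - k)%N -> t (c + k)%N = t c) ->
  (forall j, (j < k)%N -> t (j + (n - k))%N = t j) ->
  forall j, (j < n)%N -> t j = t 0%N.
Proof.
move=> cop kn t1 t2 j jn.
have step i : (i < n)%N -> t ((i + k) %% n)%N = t i.
  move=> lin; case: (ltnP (i + k)%N n) => h.
    by rewrite modn_small // t1 //; lia.
  have -> : (i + k = i - (n - k) + n)%N by lia.
  rewrite modnDr modn_small; last lia.
  by rewrite -t2 ?subnK //; lia.
have iterk m : t ((m * k) %% n)%N = t 0%N.
  elim: m => [|m IH]; first by rewrite mod0n.
  by rewrite mulSnr -modnDml step ?IH // ltn_pmod //; lia.
(* The Chinese remainder theorem gives a multiple of [k] congruent to [j] modulo [n]. *)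
have /dvdnP[m e] : (k %| chinese k n 0 j)%N.
  by rewrite /dvdn (chinese_modl cop) mod0n.
by rewrite -(iterk m) -e (chinese_modr cop) modn_small.
Qed.

Lemma rweight_coprime (K : fieldType) (k n : nat) (t : nat -> K) :
  coprime k n -> (k < n)%N -> (forall j, t j != 0) ->
  let P m := \prod_(l < m) t l in
  (forall c, (c <= n - k)%N -> rweight P k k c = 1) ->
  (forall r, (r <= k)%N -> rweight P k r (n - k) = 1) ->
  forall r c, (r <= k)%N -> (c <= n - k)%N -> rweight P k r c = 1.
Proof.
move=> cop kn t0 P hc hr.
have P0 j : P j != 0 by apply/prodf_neq0.
have PS j : P j.+1 = P j * t j by rewrite /P big_ord_recr.
have {}hc c : (c <= n - k)%N -> P (k + c)%N = P c * P k.
  move/hc; rewrite /rweight subnn add0n /P big_ord0 mulr1 => /divr1_eq; exact.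
have {}hr r : (r <= k)%N -> P n * P (k - r)%N = P (n - r)%N * P k.
  move=> rk; move: (hr _ rk); rewrite /rweight (subnKC (ltnW kn)).
  by rewrite addnC addnBA // subnK 1?ltnW // => /divr1_eq.
(* Dividing the relations of consecutive rectangles leaves an equality of two single column weights.
   For full width these are the heights [k - j] and [k - j - 1]. *)
have tc : forall j, (j < n)%N -> t j = t 0%N.
  apply: (cyclic_const cop kn) => [c ck|j jk].
    have := hc c.+1 ck; rewrite addnS !PS hc ?(ltnW ck) // (addnC k).
    by rewrite [RHS]mulrAC => /mulfI; apply; rewrite mulf_neq0.
  have h1 := hr (k - j)%N (leq_subr _ _).
  have h2 := hr (k - j).-1 ltac:(lia).
  have e1 : (k - (k - j) = j)%N by lia.
  have e2 : (k - (k - j).-1 = j.+1)%N by lia.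
  have e3 : (n - (k - j).-1 = (n - (k - j)).+1)%N by lia.
  rewrite e1 in h1; rewrite e2 e3 !PS mulrA h1 in h2.
  have -> : (j + (n - k) = n - (k - j))%N by lia.
  apply/esym/(@mulfI _ (P (n - (k - j))%N * P k)); first by rewrite mulf_neq0.
  by rewrite h2 mulrAC.
have Pz m : (m <= n)%N -> P m = t 0%N ^+ m.
  elim: m => [|m IH] mn; first by rewrite /P big_ord0.
  by rewrite PS IH 1?ltnW // tc // -exprSr.
move=> r c rk ck; rewrite /rweight !Pz; try lia.
rewrite -!exprD (_ : k + c + (k - r) = k - r + c + k)%N; last lia.
by rewrite divff ?expf_neq0.
Qed.

End RectangleWeights.

(** * Solid minors and the entries they determine *)

Section SolidMinors.
Local Open Scope ring_scope.

(** Outside column [i], row [i] vanishes, and the complementary minor is that of the identity. *)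
Lemma det_col_replace1 (D : comNzRingType) k (i : 'I_k) (v : 'I_k -> D) :
  \det (\matrix_(a, l) if l == i then v a else (a == l)%:R) = v i.
Proof.
rewrite (expand_det_row _ i) (bigD1 i) //= mxE eqxx [X in _ + X]big1 => [|l li].
  rewrite addr0 /cofactor addnn -muln2 mulnC exprM sqrrN expr1n expr1n mul1r.
  rewrite (_ : row' _ _ = 1%:M) ?det1 ?mulr1 //.
  apply/matrixP => a b; rewrite !mxE eq_sym (negPf (neq_lift _ _)).
  by rewrite (inj_eq lift_inj).
by rewrite mxE (negPf li) eq_sym (negPf li) mul0r.
Qed.

Lemma det_unit_cols (D : comNzRingType) p r (f : nat -> nat -> D) :
  (forall i j, (i < p + r)%N -> (j < p)%N -> f i j = (i == j)%:R) ->
  \det (\matrix_(i < p + r, j < p + r) f i j)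
    = \det (\matrix_(i < r, j < r) f (p + i)%N (p + j)%N).
Proof.
move=> f1; rewrite -[X in \det X]submxK.
set A := (X in \det X = _).
have -> : A = block_mx 1%:M (ursubmx (\matrix_(i < p + r, j < p + r) f i j)) 0
    (\matrix_(i < r, j < r) f (p + i)%N (p + j)%N).
  rewrite /A; congr block_mx; apply/matrixP => i j;
    rewrite !mxE //= f1 ?ltn_add2l //; last by rewrite gtn_eqF // ltn_addr.
  by rewrite ltn_addr.
by rewrite det_ublock det1 mul1r.
Qed.

Definition solid (D : comNzRingType) (m : nat -> nat -> D) r a b :=
  \det (\matrix_(i < r, j < r) m (a + i)%N (b + j)%N).

Lemma eq_solid (D : comNzRingType) (m m' : nat -> nat -> D) r a b :
  (forall i j, (a <= i < a + r)%N -> (b <= j < b + r)%N -> m i j = m' i j) ->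
  solid m r a b = solid m' r a b.
Proof.
move=> e; congr (\det _); apply/matrixP => i j; rewrite !mxE e //.
  by rewrite leq_addr ltn_add2l ltn_ord.
by rewrite leq_addr ltn_add2l ltn_ord.
Qed.

(* Expansion along the first row: only the top right corner differs. *)
Lemma solid_corner (D : comNzRingType) (m m' : nat -> nat -> D) r a b :
  (forall i j, (a <= i <= a + r)%N -> (b <= j <= b + r)%N ->
     ~~ ((i == a) && (j == b + r)%N) -> m i j = m' i j) ->
  solid m r.+1 a b - solid m' r.+1 a b
    = (m a (b + r)%N - m' a (b + r)%N) * ((-1) ^+ r * solid m r a.+1 b).
Proof.
have minor (M : nat -> nat -> D) :
    row' ord0 (col' ord_max (\matrix_(i < r.+1, j < r.+1) M (a + i)%N (b + j)%N))
    = \matrix_(i < r, j < r) M (a.+1 + i)%N (b + j)%N.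
  apply/matrixP => i l; rewrite !mxE /= addSnnS; congr (M _ (_ + _)%N).
  by rewrite /bump leqNgt (ltn_ord (l : 'I_r)).
move=> e; rewrite /solid !(expand_det_row _ ord0) -sumrB.
rewrite (bigD1 ord_max) //= [X in _ + X]big1 => [|j jm]; last first.
  have jr : (j < r)%N by rewrite ltn_neqAle -ltnS ltn_ord andbT; exact: jm.
  rewrite !mxE /= addn0 e; try lia.
  rewrite -mulrBr /cofactor -mulrBr (_ : row' _ _ = row' ord0 (col' j
    (\matrix_(i < r.+1, j < r.+1) m' (a + i)%N (b + j)%N))) ?subrr ?mulr0 //.
  apply/matrixP => i l; rewrite !mxE e //; have := ltn_ord i;
    have := ltn_ord (lift j l); rewrite /= /bump; lia.
rewrite addr0 !mxE /= addn0 mulrBl; congr (_ * _ - _ * _).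
  by rewrite /cofactor minor.
rewrite /cofactor minor; congr (_ * \det _); apply/matrixP => -[i ir] [l lr].
by rewrite !mxE /= e //; lia.
Qed.

(* The cofactor of the entry at the top right corner of the minor for the
   [r.+1] x [c.+1] rectangle is the minor for the [r] x [c] rectangle, so the
   entries are determined successively from the bottom left. *)
Lemma solid_unique (D : idomainType) k n (m m' : nat -> nat -> D) :
  (forall i j, (i < k)%N -> (j < k)%N -> m i j = (i == j)%:R) ->
  (forall i j, (i < k)%N -> (j < k)%N -> m' i j = (i == j)%:R) ->
  (forall r c, (r <= k)%N -> (c <= n - k)%N ->
     solid m r (k - r) (k - r + c) != 0) ->
  (forall r c, (r <= k)%N -> (c <= n - k)%N ->
     solid m r (k - r) (k - r + c) = solid m' r (k - r) (k - r + c)) ->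
  forall i j, (i < k)%N -> (j < n)%N -> m i j = m' i j.
Proof.
move=> m1 m'1 nz e.
(* The outer induction adds rows from the bottom; the inner one runs through a row from left to
   right. *)
suff H r : (r <= k)%N ->
    forall i j, (k - r <= i < k)%N -> (j < n)%N -> m i j = m' i j.
  by move=> i j ik; apply: (H k); rewrite // subnn.
elim: r => [|r IH] rk; first by move=> i j; lia.
move=> i j ik; have [ai|ia] := ltnP (k - r.+1) i.
  by apply: IH; rewrite ?(ltnW rk) //; lia.
have {ik ia}-> : i = (k - r.+1)%N by lia.
elim/ltn_ind: j => j IHj jn.
have [jk|kj] := ltnP j k; first by rewrite m1 ?m'1 //; lia.
(* The minor of size [r.+1] starting at row [a] and column [b] has the entry [(a, j)] as its top
   right corner. *)
set a := (k - r.+1)%N; set b := (a + (j - k).+1)%N.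
have ej : j = (b + r)%N by rewrite /b /a; lia.
have corner : (m a j - m' a j) * ((-1) ^+ r * solid m r a.+1 b) = 0.
  rewrite ej -solid_corner => [|i' j' ai bj ij].
    by rewrite /b -e ?subrr //; lia.
  have [i'a|i'a] := eqVneq i' a; last by apply: IH; lia.
  by rewrite i'a; apply: IHj; lia.
apply/eqP; rewrite -subr_eq0; have /eqP := corner.
rewrite mulf_eq0 mulf_eq0 signr_eq0 /=; case/orP => //.
have -> : a.+1 = (k - r)%N by rewrite /a; lia.
have -> : b = (k - r + (j - k))%N by rewrite /b /a; lia.
by apply: contraTT => _; apply: nz; lia.
Qed.

End SolidMinors.

(** * Normalized representatives, and points with prescribed minors *)

Section Points.
Local Open Scope ring_scope.
Local Open Scope complex_scope.
Local Open Scope quotient_scope.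
Variables (R : realType) (k n : nat) (kn : (1 <= k < n)%N).
Local Notation A := (coord_ring R kn).
Local Notation opos := (opos R kn).
Local Notation colmod := (colmod kn).
Local Notation col0 := (colmod 0).

Lemma colmod_small m : (m < n)%N -> colmod m = m :> nat.
Proof. exact: modn_small. Qed.

Lemma colmod_ord (j : 'I_n) : colmod j = j.
Proof. by apply: val_inj; rewrite /= modn_small. Qed.

Lemma cyc0E l : cyc kn col0 l = colmod l.
Proof. by apply: val_inj; rewrite /= modnDml. Qed.

(** Needed for frozen rectangles, whose [rect_cols] list a cyclic interval in another order than
    [cyc]. *)
Lemma plucker_perm (J : 'I_k -> 'I_n) (s : 'I_k -> 'I_k) (M : 'M[R[i]]_(k, n)) :
  injective s -> plucker J M != 0 -> plucker (J \o s) M != 0.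
Proof.
move=> sI; rewrite /plucker.
rewrite (_ : colsub (J \o s) M = col_perm (perm sI) (colsub J M)).
  by rewrite col_permE det_mulmx det_perm => h; rewrite mulf_neq0 // signr_eq0.
by apply/matrixP => i j; rewrite !mxE permE.
Qed.

Lemma opos_normal (p : opos) :
  exists2 M : rep R kn, p = \pi_opos M & colsub (cyc kn col0) (val M) = 1%:M.
Proof.
pose M0 := repr p; pose g := invmx (colsub (cyc kn col0) (val M0)).
have U : colsub (cyc kn col0) (val M0) \in unitmx.
  by rewrite unitmxE unitfE; apply: plucker_cyc_neq0.
have gU : g \in unitmx by rewrite unitmx_inv.
have gen : cyc_generic kn (g *m val M0).
  apply/forallP => a; rewrite /plucker -mulmx_colsub det_mulmx.
  by rewrite mulf_neq0 ?plucker_cyc_neq0 // -unitfE -unitmxE.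
exists (exist _ (g *m val M0) gen : rep R kn); last first.
  by rewrite /= -mulmx_colsub mulVmx.
by rewrite -[p]reprK; apply/eqmodP/roweqP; exists g.
Qed.

Lemma pratio_normal (M : rep R kn) J :
  colsub (cyc kn col0) (val M) = 1%:M ->
  pratio J col0 (\pi_opos M) = plucker J (val M).
Proof. by rewrite pratio_pi {2}/plucker => ->; rewrite det1 divr1. Qed.

(** Evaluation is named so that it can carry a ring morphism structure and be moved through
    determinants and products. *)
Definition cr_eval (p : opos) (f : A) : R[i] := f p.

Fact cr_eval_zmod p : zmod_morphism (cr_eval p). Proof. by []. Qed.
Fact cr_eval_monoid p : monoid_morphism (cr_eval p). Proof. by []. Qed.
HB.instance Definition _ p := GRing.isZmodMorphism.Build _ _ (cr_eval p)
  (cr_eval_zmod p).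
HB.instance Definition _ p := GRing.isMonoidMorphism.Build _ _ (cr_eval p)
  (cr_eval_monoid p).

Lemma coord_ringP (f g : A) : (forall p, f p = g p) -> f = g.
Proof. by move=> e; apply/val_inj/funext. Qed.

(* The entries of the representative whose first [k] columns are the identity,
   by Cramer's rule; junk for [i >= k]. *)
Definition entry (i j : nat) : A :=
  cpratio R kn (fun l : 'I_k => if l == i :> nat then colmod j else colmod l)
    col0.

Lemma entry_normal (M : rep R kn) (i : 'I_k) j :
  colsub (cyc kn col0) (val M) = 1%:M ->
  entry i j (\pi_opos M) = val M i (colmod j).
Proof.
move=> M1; rewrite [LHS]pratio_normal // /plucker.
rewrite -(det_col_replace1 i (fun a => val M a (colmod j))).
congr (\det _); apply/matrixP => a l; rewrite !mxE -val_eqE /=.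
case: ifP => // _; have /matrixP/(_ a l) := M1.
by rewrite !mxE cyc0E.
Qed.

Lemma cpratio_det J :
  cpratio R kn J col0 = \det (\matrix_(i < k, l < k) entry i (J l)).
Proof.
apply: coord_ringP => p; rewrite -[RHS]/(cr_eval p _) -det_map_mx.
have [M -> M1] := opos_normal p; rewrite [LHS]pratio_normal //.
congr (\det _); apply/matrixP => i l; rewrite !mxE.
by rewrite [RHS]entry_normal // colmod_ord.
Qed.

Lemma entry_unit i j : (i < k)%N -> (j < k)%N -> entry i j = (i == j)%:R.
Proof.
move=> ik jk; apply: coord_ringP => p; rewrite -[RHS]/(cr_eval p _) rmorph_nat.
have [M -> M1] := opos_normal p; rewrite (entry_normal (Ordinal ik)) //.
have /matrixP/(_ (Ordinal ik) (Ordinal jk)) := M1.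
by rewrite !mxE cyc0E.
Qed.

(** Extends [rect_cols] to rectangles of height or width 0, which give the first [k] columns. *)
Definition corner_cols r c (l : 'I_k) : 'I_n :=
  colmod (if l + r < k then l : nat else l + c)%N.

Lemma corner_cols_solid r c : (r <= k)%N -> (c <= n - k)%N ->
  cpratio R kn (corner_cols r c) col0 = solid entry r (k - r) (k - r + c).
Proof.
move=> rk ck; rewrite cpratio_det.
pose f i j := entry i (if (j + r < k)%N then j else j + c)%N.
rewrite (_ : \matrix_(i, l) _ = \matrix_(i < k, l < k) f i l); last first.
  apply/matrixP => i l; rewrite !mxE /f colmod_small //.
  by have := ltn_ord l; case: ifP; lia.
(* The first [k - r] columns are unit vectors. The free size [q] avoids a cast from [k - r + r] to
   [k]. *)
have det_f q : (k - r + r = q)%N -> \det (\matrix_(i < q, l < q) f i l)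
    = \det (\matrix_(i < r, j < r) f (k - r + i)%N (k - r + j)%N).
  move=> <-; apply: det_unit_cols => i j ik jk; rewrite /f.
  by rewrite (_ : (j + r < k)%N) ?entry_unit //; lia.
rewrite det_f ?subnK //; congr (\det _); apply/matrixP => i j; rewrite !mxE /f.
by rewrite ltnNge (_ : (k <= _)%N) /= 1?addnAC //; lia.
Qed.

Lemma solid_eval (p : opos) r a b :
  solid entry r a b p = solid (fun i j => entry i j p) r a b.
Proof.
rewrite -[LHS]/(cr_eval p _) -det_map_mx; congr (\det _).
by apply/matrixP => i j; rewrite !mxE.
Qed.

Lemma corner_cols_inj r c : (c <= n - k)%N -> injective (corner_cols r c).
Proof.
move=> ck l l'; have [lk l'k] := (ltn_ord l, ltn_ord l').
move/(congr1 val) => /=; rewrite !modn_small; try by case: ifP; lia.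
by move=> e; apply: val_inj => /=; move: e; do 2!case: ifP; lia.
Qed.

Lemma cyc_inj a : injective (cyc kn a).
Proof.
move=> l l' /(congr1 val) /= /eqP; rewrite eqn_modDl !modn_small.
- by move/eqP/val_inj.
- by have := ltn_ord l'; lia.
- by have := ltn_ord l; lia.
Qed.

(** A single point that shows all these coordinates to be nonzero in the coordinate ring. *)
Lemma vandermonde_point : exists p : opos,
  forall J, injective J -> pratio J col0 p != 0.
Proof.
pose r : 'rV[R[i]]_n := \row_j (j : nat)%:R.
pose M : 'M[R[i]]_(k, n) := \matrix_(i, j) r 0 j ^+ i.
have nz J : injective J -> plucker J M != 0.
  move=> J_inj; rewrite /plucker.
  have -> : colsub J M = Vandermonde k (colsub J r).
    by apply/matrixP => i j; rewrite !mxE.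
  rewrite det_Vandermonde; apply/prodf_neq0 => i _; apply/prodf_neq0 => j ltij.
  rewrite !mxE subr_eq0 eqr_nat; apply: contraTneq ltij => /val_inj/J_inj ->.
  by rewrite ltnn.
have gM : cyc_generic kn M by apply/forallP => a; apply/nz/cyc_inj.
exists (\pi_opos (exist _ M gM)) => J /nz h.
by rewrite pratio_pi mulf_neq0 // invr_eq0 plucker_cyc_neq0.
Qed.

(** Along the line [M + t *: E] the product of the cyclic minors is a polynomial that is nonzero at
    [t = 0], so it has finitely many roots. *)
Lemma generic_perturb (M E : 'M[R[i]]_(k, n)) :
  cyc_generic kn M -> exists2 e : R[i], e != 0 & cyc_generic kn (M + e *: E).
Proof.
move=> gM.
pose f a : {poly R[i]} :=
  \det (colsub (cyc kn a) (map_mx polyC M + 'X *: map_mx polyC E)).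
have fE a t : (f a).[t] = plucker (cyc kn a) (M + t *: E).
  rewrite -[LHS]/(horner_eval t _) -det_map_mx; congr (\det _).
  by apply/matrixP => i j; rewrite !mxE /= horner_evalE !hornerE.
pose g := \prod_a f a.
have g0 : g != 0.
  apply/prodf_neq0 => a _; apply: contraTneq (forallP gM a) => z.
  by rewrite -[M]addr0 -(scale0r E) -fE z horner0 eqxx.
pose ts : seq R[i] := [seq m.+1%:R | m <- iota 0 (size g)].
have : ~~ all (root g) ts.
  apply/negP => /(max_poly_roots g0);
    rewrite map_inj_uniq ?iota_uniq => [/(_ isT)|].
    by rewrite size_map size_iota ltnn.
  by move=> a b /eqP; rewrite eqr_nat eqSS => /eqP.
case/allPn => _ /mapP[m _ ->] gm; exists m.+1%:R; first by rewrite pnatr_eq0.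
apply/forallP => a; rewrite -fE; apply: contraNneq gm => z.
by rewrite rootE horner_prod (bigD1 a) //= z mul0r.
Qed.

(* Perturbing the top right entry of the solid minor [v] leaves unchanged all
   minors that do not contain this entry. *)
Lemma rect_perturb (v : rect_idx k n) :
  exists p q : opos, [/\
    forall u, cpratio R kn (rect_cols kn u) col0 p != 0,
    forall u : rect_idx k n, ~~ ((v.1 <= u.1)%N && (v.2 <= u.2)%N) ->
      cpratio R kn (rect_cols kn u) col0 q = cpratio R kn (rect_cols kn u) col0 p
  & cpratio R kn (rect_cols kn v) col0 q != cpratio R kn (rect_cols kn v) col0 p].
Proof.
have [p p0] := vandermonde_point; have [M eM M1] := opos_normal p.
have [vk vn] := (ltn_ord v.1, ltn_ord v.2).
(* Row [k - v.1.+1] and column [k + v.2] locate the top right entry of the minor [v]. This column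
   lies beyond the first [k], so the perturbed matrix stays normalized. *)
have ik : (k - v.1.+1 < k)%N by lia.
have jn : (k + v.2 < n)%N by lia.
have [e e0 gN] :=
  generic_perturb (delta_mx (Ordinal ik) (Ordinal jn)) (valP M).
pose N : rep R kn := exist _ (val M + e *: delta_mx (Ordinal ik) (Ordinal jn)) gN.
have N1 : colsub (cyc kn col0) (val N) = 1%:M.
  rewrite -M1; apply/matrixP => i j; rewrite !mxE -!val_eqE /=.
  rewrite modnDml modn_small; last by have := ltn_ord j; lia.
  by rewrite (_ : (_ == k + _)%N = false) ?andbF ?mulr0 ?addr0 //;
    have := ltn_ord j; lia.
have rectE (u : rect_idx k n) x : cpratio R kn (rect_cols kn u) col0 x
    = solid (fun i j => entry i j x) u.1.+1 (k - u.1.+1) (k - u.1.+1 + u.2.+1).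
  have [? ?] := (ltn_ord u.1, ltn_ord u.2).
  by rewrite -solid_eval -corner_cols_solid.
have entryN i j : (i < k)%N -> (j < n)%N -> entry i j (\pi_opos N)
    = entry i j p + e * ((i == k - v.1.+1) && (j == k + v.2))%N%:R.
  move=> lik ljn; rewrite eM !(entry_normal (Ordinal lik)) // !mxE.
  by rewrite -!val_eqE /= modn_small.
exists p, (\pi_opos N); split=> [u|u uv|].
- by apply/p0/corner_cols_inj; apply: ltn_ord.
- have [? ?] := (ltn_ord u.1, ltn_ord u.2).
  rewrite !rectE; apply: eq_solid => i j ? ?; rewrite entryN; try lia.
  by rewrite (_ : _ && _ = false) ?mulr0 ?addr0 //; lia.
(* Up to sign the difference is [e] times the minor of the [v.1] x [v.2] rectangle, which is nonzero
   at [p]. *)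
rewrite eq_sym -subr_eq0 !rectE solid_corner => [|i j ? ? ?]; last first.
  rewrite entryN; try lia.
  by rewrite (_ : _ && _ = false) ?mulr0 ?addr0 //; lia.
rewrite entryN; try lia.
rewrite eqxx (_ : (_ + v.1 == k + v.2)%N); last lia.
rewrite mulr1 opprD addNKr !mulf_neq0 ?oppr_eq0 ?signr_eq0 //.
have -> : (k - v.1.+1).+1 = (k - v.1)%N by lia.
have -> : (k - v.1.+1 + v.2.+1 = k - v.1 + v.2)%N by lia.
rewrite -solid_eval -corner_cols_solid; try lia.
by apply/p0/corner_cols_inj; lia.
Qed.

End Points.

(** * Cluster automorphisms in terms of weights *)

Section ClusterAutomorphisms.
Local Open Scope ring_scope.
Local Open Scope complex_scope.
Variables (R : realType) (k n : nat) (kn : (1 <= k < n)%N).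
Local Notation A := (coord_ring R kn).
Local Notation col0 := (colmod kn 0).
Local Notation toK := (@FracField.tofrac A).

Definition rect_var (u : rect_idx k n) : A := cpratio R kn (rect_cols kn u) col0.

Lemma rect_var_neq0 u : rect_var u != 0.
Proof.
have [p [_ [p0 _ _]]] := rect_perturb R kn u.
by apply: contra_neq (p0 u) => z; rewrite -/(rect_var u) z.
Qed.

Lemma frozen_neq0 u p : u \notin @rect_mutable k n -> rect_var u p != 0.
Proof.
case: u => r c; rewrite unfold_in /= => froz; have [k0 ltkn] := andP kn.
have [rk ck] := (ltn_ord r, ltn_ord c).
rewrite /= /pratio mulf_neq0 ?invr_eq0 ?plucker_cyc_neq0 //.
have ltk l : ((l + r.+1) %% k < k)%N by rewrite ltn_mod.
(* The rotation by [r.+1] that turns the order of [rect_cols] into that of a cyclic interval. *)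
pose s (l : 'I_k) := Ordinal (ltk l).
rewrite (_ : rect_cols kn (r, c) = cyc kn (colmod kn (k - r.+1 + c.+1)) \o s).
  apply: plucker_perm; last exact: plucker_cyc_neq0.
  move=> l l' /(congr1 val)/eqP /=; rewrite eqn_modDr !modn_small //.
  by move/eqP/val_inj.
apply/funext => l; apply: val_inj; rewrite /= modnDml.
have lk := ltn_ord l; case: ifP => lr.
  rewrite (modn_small lr).
  have [e|e] : r.+1 = k \/ c.+1 = (n - k)%N by lia.
    by lia.
  have -> : (k - r.+1 + c.+1 + (l + r.+1) = l + n)%N by lia.
  by rewrite modnDr.
have -> : ((l + r.+1) %% k = l + r.+1 - k)%N.
  by rewrite -{1}(subnK (_ : k <= l + r.+1)%N) ?modnDr ?modn_small //; lia.
by congr (_ %% n)%N; lia.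
Qed.

Lemma corner_cols_trivial r c : (r == 0)%N || (c == 0)%N ->
  cpratio R kn (corner_cols kn r c) col0 = 1.
Proof.
move=> rc; apply: coord_ringP => p.
rewrite /= /pratio (_ : corner_cols kn r c = cyc kn col0).
  by rewrite divff ?plucker_cyc_neq0.
apply/funext => l; rewrite cyc0E /corner_cols.
have := ltn_ord l; case: ifP => // h lk; congr (colmod kn); lia.
Qed.

Variable phi : {lrmorphism A -> A}.

Lemma fixed_rect_var_id : (forall u, phi (rect_var u) = rect_var u) ->
  forall f, phi f = f.
Proof.
move=> fix_rect.
have fix_corner r c : (r <= k)%N -> (c <= n - k)%N ->
    phi (cpratio R kn (corner_cols kn r c) col0)
      = cpratio R kn (corner_cols kn r c) col0.
  case: r => [|r]; first by rewrite corner_cols_trivial ?rmorph1.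
  case: c => [|c]; first by rewrite corner_cols_trivial ?orbT ?rmorph1.
  by move=> rk ck; apply: (fix_rect (Ordinal rk, Ordinal ck)).
have fix_entry i j : (i < k)%N -> (j < n)%N ->
    phi (entry R kn i j) = entry R kn i j.
  (* The matrices compared, over the domain [A], are the generic normalized matrix and its image
     under [phi]. *)
  move=> ik jn; symmetry; apply: (@solid_unique _ k n (entry R kn)
    (fun i j => phi (entry R kn i j)) _ _ _ _ i j ik jn) => {ik jn} {}i {}j ik jk.
  - exact: entry_unit.
  - by rewrite entry_unit // rmorph_nat.
  - rewrite -corner_cols_solid //; have [p p0] := vandermonde_point R kn.
    apply: contra_neq (p0 _ (corner_cols_inj (r := i) jk)).
    by move/(congr1 (cr_eval p)).
  - rewrite -corner_cols_solid // -fix_corner // corner_cols_solid // -det_map_mx.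
    by congr (\det _); apply/matrixP => a b; rewrite !mxE.
have fix0 J : phi (cpratio R kn J col0) = cpratio R kn J col0.
  rewrite cpratio_det -det_map_mx; congr (\det _); apply/matrixP => i l.
  by rewrite !mxE; apply: fix_entry.
(* A change of the normalizing interval is a division in the domain [A] by a fixed nonzero
   element. *)
have fixa J a : phi (cpratio R kn J a) = cpratio R kn J a.
  have e : cpratio R kn J a * cpratio R kn (cyc kn a) col0 = cpratio R kn J col0.
    apply: coord_ringP => p; rewrite cfunE /= /pratio mulrA.
    by rewrite divfK ?plucker_cyc_neq0.
  have nz : cpratio R kn (cyc kn a) col0 != 0.
    have [p p0] := vandermonde_point R kn.
    apply: contra_neq (p0 _ (cyc_inj (kn := kn) (a := a))).
    by move/(congr1 (cr_eval p)).
  by apply: (mulIf nz); rewrite e -(fix0 (cyc kn a)) -rmorphM e; apply: fix0.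
suff H g : is_regular g -> forall rg : g \in regular (kn := kn),
    phi (CoordRing rg) = CoordRing rg.
  by case=> g rg; apply/H/regularP.
elim=> {g} [c|J a|f g rf IHf rg IHg|f g rf IHf rg IHg] rfg.
- have -> : CoordRing rfg = c%:A.
    by apply: coord_ringP => p; rewrite !cfunE mulr1.
  by rewrite linearZ /= rmorph1.
- by rewrite (_ : CoordRing rfg = cpratio R kn J a) //; apply: val_inj.
- have /regularP Rf := rf; have /regularP Rg := rg.
  have -> : CoordRing rfg = CoordRing Rf + CoordRing Rg by apply: val_inj.
  by rewrite rmorphD; congr (_ + _); [apply: IHf|apply: IHg].
- have /regularP Rf := rf; have /regularP Rg := rg.
  have -> : CoordRing rfg = CoordRing Rf * CoordRing Rg by apply: val_inj.
  by rewrite rmorphM; congr (_ * _); [apply: IHf|apply: IHg].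
Qed.

Hypothesis phi_aut : cluster_automorphism phi.

Let phi_inj : injective phi. Proof. exact: bij_inj phi_aut.1. Qed.

(** [phi] scales a mutable variable and its mutation, hence also their product [a + b], the sum of
    the two exchange monomials. Balance follows because [a] and [b] are linearly independent, as
    seen at two points where [b] agrees and [a] does not. *)
Lemma cluster_automorphism_weights : exists w : rect_idx k n -> R[i],
  [/\ forall u, w u != 0,
      forall u, phi (rect_var u) = w u *: rect_var u
    & hex_balanced k (n - k) (rect_ext w)].
Proof.
have [_ scl] := phi_aut.
have ex u : exists c : R[i], c != 0 /\ phi (rect_var u) = c *: rect_var u.
  have [|c c0 e] := scl (cvar (rect_seed R kn) u).
    by exists (rect_seed R kn), u; split=> //; constructor.
  exists c; split=> //; apply/eqP; rewrite -tofrac_eq -frac_map_tofrac //.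
  by rewrite e -tofracM mulr_algl.
have [w ew] := choice ex.
exists w; split=> [u|u|]; try by case: (ew u).
move=> r c rk ck.
pose v : rect_idx k n := (Ordinal (ltnW rk), Ordinal (ltnW ck)).
have mv : v \in @rect_mutable k n by rewrite unfold_in /= rk ck.
have := prod_rect_in w v; rewrite /= => <-.
have := prod_rect_out w v; rewrite /= => <-.
set wa := \prod_(u | _) _; set wb := \prod_(u | _) _.
pose a : A := \prod_(u | rect_arrow u v) rect_var u.
pose b : A := \prod_(u | rect_arrow v u) rect_var u.
have scale_prod (P : pred (rect_idx k n)) : phi (\prod_(u | P u) rect_var u)
    = (\prod_(u | P u) w u) *: \prod_(u | P u) rect_var u.
  rewrite rmorph_prod; apply: (big_ind3 (fun x y z => x = y *: z)).
  - by rewrite scale1r.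
  - by move=> x x' y y' z z' -> ->; rewrite -scalerAl -scalerAr scalerA.
  - by move=> u _; case: (ew u).
have fmap f g : g != 0 ->
    frac_map phi (toK f / toK g) = toK (phi f) / toK (phi g).
  exact: frac_map_div.
have [c' e] : exists c' : R[i], wa *: a + wb *: b = c' *: (a + b).
  have [|c' _] := scl (cvar (mutate (rect_seed R kn) v) v).
    exists (mutate (rect_seed R kn) v), v; split=> //.
    by constructor=> //; constructor.
  rewrite /= eqxx /mutate_var prod_exch_pos prod_exch_neg /=.
  rewrite -!rmorph_prod -/a -/b -tofracD fmap ?rect_var_neq0 //.
  have -> : phi (a + b) = wa *: a + wb *: b.
    by rewrite rmorphD; congr (_ + _); apply: scale_prod.
  have [wv0 ->] := ew v.
  rewrite mulrA -tofracM => /eqP.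
  have v0 : toK (rect_var v) != 0 by rewrite tofrac_eq0; apply: rect_var_neq0.
  have wv : toK (w v *: rect_var v) != 0.
    rewrite tofrac_eq0 -mulr_algl mulf_neq0 ?rect_var_neq0 //.
    by rewrite -tofrac_eq0 toK_alg_neq0.
  rewrite (eqr_div _ _ wv v0).
  rewrite -!tofracM tofrac_eq => /eqP e; exists (c' * w v).
  apply: (mulIf (rect_var_neq0 v)); rewrite e mulr_algl -!scalerAl -scalerAr.
  by rewrite scalerA.
(* The largest rectangle of the exchange relation: its top right entry lies in no other minor of [a]
   or [b]. *)
pose u0 : rect_idx k n := (Ordinal rk, Ordinal ck).
have [p [q [p0 pq qv]]] := rect_perturb R kn u0.
have evalE x : wa * a x + wb * b x = c' * (a x + b x).
  by have /(congr1 (cr_eval x)) := e.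
have bpq : b q = b p.
  rewrite -[LHS]/(cr_eval q _) -[RHS]/(cr_eval p _) !rmorph_prod.
  apply: eq_bigr => u; rewrite /rect_arrow /= => vu; apply: pq => /=; lia.
have b0 : b p != 0.
  rewrite -[b p]/(cr_eval p _) rmorph_prod; apply/prodf_neq0 => u _; exact: p0.
have apq : a q - a p != 0.
  have vu0 : rect_arrow u0 v by rewrite /rect_arrow /= !eqxx !orbT.
  pose a' : A := \prod_(u | rect_arrow u v && (u != u0)) rect_var u.
  have aE x : a x = rect_var u0 x * a' x by rewrite /a (bigD1 u0 vu0).
  have a'pq : a' q = a' p.
    rewrite -[LHS]/(cr_eval q _) -[RHS]/(cr_eval p _) !rmorph_prod.
    apply: eq_bigr => u /andP[uv uu0]; apply: pq; move: uv uu0.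
    by rewrite /rect_arrow [u == _]/eq_op /= /eq_op /=; lia.
  have a'0 : a' p != 0.
    rewrite -[a' p]/(cr_eval p _) rmorph_prod.
    by apply/prodf_neq0 => u _; apply: p0.
  by rewrite !aE a'pq -mulrBl mulf_neq0 // subr_eq0.
have := evalE q; rewrite bpq => eq; have ep := evalE p.
(* Subtracting the evaluations at [p] and [q] eliminates [b]. *)
have ec : wa = c'.
  apply/eqP; rewrite -subr_eq0 -(mulIr_eq0 _ (mulIf apq)); apply/eqP.
  transitivity ((wa * a q + wb * b p) - c' * (a q + b p)
    - ((wa * a p + wb * b p) - c' * (a p + b p))); first by ring.
  by rewrite eq ep !subrr.
by move: ep; rewrite ec mulrDr => /addrI/(mulIf b0).
Qed.

End ClusterAutomorphisms.

(** * Stabilizers in the coprime and non-coprime cases *)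

Section Stabilizers.
Local Open Scope ring_scope.
Local Open Scope complex_scope.
Local Open Scope quotient_scope.
Variables (R : realType) (k n : nat) (kn : (1 <= k < n)%N).
Local Notation A := (coord_ring R kn).
Local Notation col0 := (colmod kn 0).
Local Notation toK := (@FracField.tofrac A).

Let k_gt0 : (0 < k)%N. Proof. by case/andP: kn. Qed.
Let ltkn : (k < n)%N. Proof. by case/andP: kn. Qed.

Lemma coprime_stabilizer (phi : {lrmorphism A -> A}) p : coprime k n ->
  cluster_automorphism phi -> fixes_point phi p -> forall f, phi f = f.
Proof.
move=> cop aut fix_p.
have [w [w0 phiw bal]] := cluster_automorphism_weights aut.
have W0 r c : rect_ext w r c != 0 by apply/prodf_neq0.
have [t t0 Wt] :=
  hex_balanced_rweight k_gt0 W0 (rect_ext_0l w) (rect_ext_0r w) bal.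
have froz u : u \notin @rect_mutable k n -> w u = 1.
  move=> mu; have xp := frozen_neq0 p mu.
  apply: (mulIf xp); rewrite mul1r -[RHS]fix_p phiw.
  by rewrite cfunE.
have frozW r c : (r <= k)%N -> (c <= n - k)%N -> (r == k) || (c == n - k)%N ->
    rect_ext w r c = 1.
  case: r => [|r] rk; first by rewrite rect_ext_0l.
  case: c => [|c] ck rc; first by rewrite rect_ext_0r.
  rewrite (rect_extE w (Ordinal rk, Ordinal ck)) froz // unfold_in /=; lia.
apply: fixed_rect_var_id => u; rewrite phiw -(rect_extE w u).
rewrite Wt ?ltn_ord // (rweight_coprime cop ltkn t0) ?ltn_ord ?scale1r //.
  by move=> c ck; rewrite -Wt // frozW // eqxx.
by move=> r rk; rewrite -Wt // frozW // eqxx orbT.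
Qed.

(** The columns of an r x c rectangle form the intervals [[0, k - r)] and [[k - r + c, k + c)],
    whose weights are quotients of initial products. *)
Lemma torus_weight_rect (t : {ffun 'I_n -> R[i]}) (u : rect_idx k n) :
  (forall j, t j != 0) ->
  torus_weight kn t (rect_cols kn u) col0
  = rweight (fun m => \prod_(l < m) t (colmod kn l)) k u.1.+1 u.2.+1.
Proof.
move=> t0; rewrite /torus_weight /rweight.
have [rk ck] := (ltn_ord u.1, ltn_ord u.2).
set r := u.1.+1; set c := u.2.+1.
pose tau m := t (colmod kn m).
have tau0 a b : \prod_(a <= l < b) tau l != 0.
  by rewrite prodf_seq_neq0; apply/allP => l _; apply: t0.
have E m : \prod_(l < m) t (colmod kn l) = \prod_(0 <= l < m) tau l.
  by rewrite big_mkord.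
rewrite !E; have -> : \prod_l t (cyc kn col0 l) = \prod_(0 <= l < k) tau l.
  by rewrite big_mkord; apply: eq_bigr => l _; rewrite cyc0E.
have -> : \prod_l t (rect_cols kn u l)
    = \prod_(0 <= l < k - r) tau l * \prod_(k - r + c <= l < k + c) tau l.
  rewrite -(big_mkord xpredT (fun l => tau (if l + r < k then l else l + c)%N)).
  rewrite (big_cat_nat (n := (k - r)%N)) ?leq_subr //=; congr (_ * _).
    by apply: eq_big_nat => l /andP[_ lk]; rewrite (_ : (l + r < k)%N) //; lia.
  rewrite (big_addn (k - r) (k + c) c) addnK; apply: eq_big_nat => l /andP[lk _].
  by rewrite ltnNge (_ : (k <= l + r)%N) //; lia.
have -> : \prod_(0 <= l < k + c) tau l
    = \prod_(0 <= l < k - r + c) tau l * \prod_(k - r + c <= l < k + c) tau l.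
  by rewrite -big_cat_nat // leq_add2r leq_subr.
by field; rewrite !tau0.
Qed.

Lemma torus_graded (t : {ffun 'I_n -> R[i]}) (t0 : forall j, t j != 0) :
  graded (torus_pull (kn := kn) t0) (@rect_mutable k n) (rect_seed R kn)
    (fun u => torus_weight kn t (rect_cols kn u) col0).
Proof.
have P0 m : \prod_(l < m) t (colmod kn l) != 0 by apply/prodf_neq0.
have w0 (u : rect_idx k n) : torus_weight kn t (rect_cols kn u) col0 != 0.
  by rewrite torus_weight_rect // rweight_neq0.
split=> //; first exact: rect_seed_skew.
  apply/rect_balancedP => // v; rewrite unfold_in => /andP[rk ck].
  rewrite prod_rect_in prod_rect_out.
  have extE r c : (r <= k)%N -> (c <= n - k)%N ->
      rect_ext (fun u : rect_idx k n => torus_weight kn t (rect_cols kn u) col0)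
        r c
      = rweight (fun m => \prod_(l < m) t (colmod kn l)) k r c.
    move=> rk' ck'; rewrite -[RHS](@rect_ext_val _ k n) // => [|?|?].
    - by congr rect_ext; apply/funext => u; rewrite torus_weight_rect.
    - exact: rweight_0l.
    - exact: rweight_0r.
  rewrite !extE; try lia.
  exact: (rweight_balanced (m := n - k) P0 rk ck).
move=> u; rewrite /scales /= frac_map_tofrac; last first.
  exact: bij_inj (torus_pull_bij kn t0).
rewrite -tofracM mulr_algl; congr (toK _); exact: torus_pull_cpratio.
Qed.

(** At the fixed point [p] the variables of [s] do not vanish, so their weights are 1;
    [reachable_graded] carries this back to the rectangle seed. *)
Lemma cluster_torus_weight (phi : {lrmorphism A -> A}) w p s :
  injective phi -> graded phi (@rect_mutable k n) (rect_seed R kn) w ->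
  fixes_point phi p -> is_seed s -> cluster_torus s p -> forall u, w u = 1.
Proof.
move=> phi_inj gr fix_p rs sp.
have [ws [_ _ _ sc]] := reachable_graded phi_inj gr rs.
apply=> u; have [f ef fp] := sp u.
have := sc u; rewrite /scales ef frac_map_tofrac // -tofracM mulr_algl.
move/eqP; rewrite tofrac_eq => /eqP e.
apply: (mulIf fp); rewrite mul1r -[RHS]fix_p e.
by rewrite cfunE.
Qed.

(* Row [i] is supported on the columns congruent to [i] modulo [d], so that
   rescaling all columns of one residue class does not move the row space. *)
Definition residue_mx d : 'M[R[i]]_(k, n) :=
  \matrix_(i, j) if (i %% d == j %% d)%N then (j : nat)%:R ^+ (i %/ d) else 0.

(** The entries of a left kernel vector in one residue class are the coefficients of a polynomial of
    degree less than [k / d]. It vanishes at the [k / d] distinct column indices of the interval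
    lying in that class, so it is zero. *)
Lemma residue_mx_generic d : (d %| k)%N -> (d %| n)%N ->
  cyc_generic kn (residue_mx d).
Proof.
move=> dk dn; have d0 : (0 < d)%N by apply: dvdn_gt0 dk.
apply/forallP => a; apply/det0P => -[u u0 uN]; case/eqP: u0.
apply/rowP => i0; rewrite mxE; set rho := (i0 %% d)%N.
pose q : {poly R[i]} := \sum_(i < k | (i %% d)%N == rho) u 0 i *: 'X^(i %/ d)%N.
have qk : q`_(i0 %/ d)%N = u 0 i0.
  rewrite coef_sum (bigD1 i0) //= coefZ coefXn eqxx mulr1 big1 ?addr0 // => i.
  case/andP=> /eqP im ii0; rewrite coefZ coefXn (_ : (_ == _) = false) ?mulr0 //.
  apply: contraNF ii0 => /eqP di; apply/eqP/val_inj => /=.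
  by rewrite (divn_eq i d) (divn_eq i0 d) im -di.
rewrite -qk; suff -> : q = 0 by rewrite coef0.
(* The first offset for which [a + l0] is congruent to [rho] modulo [d]. *)
pose l0 := ((rho + (d - a %% d)) %% d)%N.
have l0d : (l0 < d)%N by rewrite ltn_mod.
have kd := divnK dk.
pose col s := colmod kn (a + (l0 + s * d))%N.
pose rs : seq R[i] := [seq (col s : nat)%:R | s <- iota 0 (k %/ d)%N].
have lk s : (s < k %/ d)%N -> (l0 + s * d < k)%N by nia.
have col_root s : (s < k %/ d)%N -> root q (col s : nat)%:R.
  move=> sk; pose l : 'I_k := Ordinal (lk s sk).
  apply/eqP; have /rowP/(_ l) := uN; rewrite !mxE => <-.
  rewrite /q horner_sum big_mkcond /=; apply: eq_bigr => i _.
  rewrite !mxE (_ : cyc kn a l = col s) //.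
  (* Since [d] divides [n], reduction modulo [n] preserves residues modulo [d]. *)
  have -> : (col s %% d = rho)%N.
    rewrite /= modn_dvdm // (_ : a + (l0 + s * d) = s * d + (a + l0))%N; last lia.
    rewrite modnMDl modnDmr -modnDml.
    rewrite (_ : a %% d + (rho + (d - a %% d)) = rho + d)%N.
      by rewrite modnDr modn_mod.
    by have := ltn_pmod a d0; lia.
  by case: ifP => _; rewrite ?mulr0 // hornerZ hornerXn.
apply/eqP; apply: contraT => q0.
have : (size rs < size q)%N.
  apply: max_poly_roots => //.
    by apply/allP => _ /mapP[s sk ->]; apply: col_root; rewrite mem_iota in sk.
  rewrite map_inj_in_uniq ?iota_uniq // => s s'; rewrite !mem_iota => sk s'k.
  move/eqP; rewrite eqr_nat => /eqP/val_inj e.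
  have := @cyc_inj _ _ kn a (Ordinal (lk s sk)) (Ordinal (lk s' s'k)) e.
  by case; nia.
rewrite size_map size_iota ltnNge; case/negP.
apply: leq_trans (size_sum _ _ _) _; apply/bigmax_leqP => i _.
apply: leq_trans (size_scale_leq _ _) _; rewrite size_polyXn.
by rewrite ltn_divLR ?kd.
Qed.

(** The value 2 stands for any scalar other than 0 and 1. *)
Definition residue_weight d : {ffun 'I_n -> R[i]} :=
  [ffun j : 'I_n => if (d %| j)%N then 2 else 1].

Lemma residue_weight_neq0 d j : residue_weight d j != 0.
Proof. by rewrite ffunE; case: ifP => _; rewrite ?oner_eq0 ?pnatr_eq0. Qed.

Definition residue_aut d : {lrmorphism A -> A} :=
  torus_pull (residue_weight_neq0 d).

Lemma residue_aut_fixes d : (d %| k)%N -> (d %| n)%N ->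
  exists p, fixes_point (residue_aut d) p.
Proof.
move=> dk dn.
pose M : rep R kn := exist _ (residue_mx d) (residue_mx_generic dk dn).
exists (\pi_(opos R kn) M) => f; rewrite /= opos_scale_pi; congr (f _).
apply/eqmodP; rewrite /= roweq_sym; apply/roweqP.
pose g : 'rV[R[i]]_k := \row_i if (d %| i)%N then 2 else 1.
exists (diag_mx g).
  rewrite unitmxE unitfE det_diag; apply/prodf_neq0 => i _; rewrite mxE.
  by case: ifP => _; rewrite ?oner_eq0 ?pnatr_eq0.
apply/matrixP => i j; rewrite /= /col_scale mul_mx_diag mul_diag_mx !mxE ffunE.
case: eqP => [e|_]; last by rewrite mulr0 mul0r.
by rewrite mulrC /dvdn e.
Qed.

(** The 1 x 1 rectangle has weight [t k / t (k - 1) = 2], because [d] divides [k] but not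
    [k - 1]. *)
Lemma residue_aut_weight d : (1 < d)%N -> (d %| k)%N ->
  exists u, torus_weight kn (residue_weight d) (rect_cols kn u) col0 != 1.
Proof.
move=> d1 dk; have m0 : (0 < n - k)%N by rewrite subn_gt0.
exists (Ordinal k_gt0, Ordinal m0); rewrite torus_weight_rect /=; last first.
  exact: residue_weight_neq0.
rewrite /rweight.
set t := residue_weight d; pose P m := \prod_(l < m) t (colmod kn l).
rewrite -!/(P _); have P0 m : P m != 0.
  by apply/prodf_neq0 => l _; apply: residue_weight_neq0.
have PS m : P m.+1 = P m * t (colmod kn m) by rewrite /P big_ord_recr.
have tk : t (colmod kn k) = 2 by rewrite ffunE colmod_small // dk.
have tk1 : t (colmod kn k.-1) = 1.
  rewrite ffunE colmod_small ?(leq_ltn_trans (leq_pred k)) //.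
  case: ifP => // dk1; move: (dvdn_sub dk dk1).
  by rewrite (_ : k - k.-1 = 1)%N ?dvdn1 ?gtn_eqF //; lia.
rewrite !addn1 subn1 PS (prednK k_gt0) tk.
have -> : P k = P k.-1 by rewrite -{1}(prednK k_gt0) PS tk1 mulr1.
rewrite (_ : _ / _ = 2) ?(eqr_nat _ 2 1) //.
by field; rewrite P0.
Qed.

Lemma residue_aut_cluster d : cluster_automorphism (residue_aut d).
Proof.
have bij := torus_pull_bij kn (residue_weight_neq0 d).
split=> // x [s [u [rs ->]]].
have [w [_ _ w0 sc] _] :=
  reachable_graded (bij_inj bij) (torus_graded (residue_weight_neq0 d)) rs.
by exists (w u); [apply: w0|apply: sc].
Qed.

Lemma gcd_stabilizer : (1 < gcdn k n)%N -> (stabilizer_locus R kn !=set0)%classic.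
Proof.
move=> d1; have [dk dn] := (dvdn_gcdl k n, dvdn_gcdr k n).
have [p fix_p] := residue_aut_fixes dk dn.
exists p; exists (residue_aut (gcdn k n)); split=> //.
  exact: residue_aut_cluster.
have [u wu] := residue_aut_weight d1 dk.
exists (rect_var R kn u) => e.
have /eqP := etrans (esym (torus_pull_cpratio _ (residue_weight_neq0 _) _ _)) e.
rewrite -subr_eq0 -[X in _ - X]scale1r -scalerBl -mulr_algl mulf_eq0.
rewrite (negPf (rect_var_neq0 R kn u)) orbF -tofrac_eq0; apply/negP/toK_alg_neq0.
by rewrite subr_eq0.
Qed.

Lemma gcd_deep : (1 < gcdn k n)%N -> (deep_locus R kn !=set0)%classic.
Proof.
move=> d1; have [dk dn] := (dvdn_gcdl k n, dvdn_gcdr k n).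
have [p fix_p] := residue_aut_fixes dk dn.
exists p => -[s rs sp]; have [u /eqP[]] := residue_aut_weight d1 dk.
apply: (cluster_torus_weight _ (torus_graded _) fix_p rs sp u).
exact: bij_inj (torus_pull_bij kn _).
Qed.

End Stabilizers.

Theorem corollary4p44 (R : realType) (k n : nat) (kn : (1 <= k < n)%N) :
  (stabilizer_locus R kn = set0 <-> gcdn k n = 1%N) /\
  ((1 < gcdn k n)%N -> deep_locus R kn <> set0).
Proof.
split; last by move=> /(gcd_deep R kn)/set0P/eqP.
split=> [e|/eqP cop].
  have g0 : (0 < gcdn k n)%N by have [k0 _] := andP kn; rewrite gcdn_gt0 k0.
  apply/eqP; rewrite eqn_leq g0 andbT leqNgt; apply/negP.
  by move=> /(gcd_stabilizer R kn)/set0P; rewrite e eqxx.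
apply/eqP; apply: contraT => /set0P[p [phi [aut fix_p [f []]]]].
exact: (coprime_stabilizer cop aut fix_p).
Qed.
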